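(* Let $k$ be a commutative ring with unit and let $A$ be an augmented commutative (unital) shuffle algebra over $k$ with $A(0)=k$. Then the graded $k$-algebra $\Psi(A)$ is a graded divided power algebra, i.e. it carries a system of divided power operations $\gamma_n$ ($n\geq 0$) on its homogeneous elements of positive degree.
   Context: Symmetric sequences: a symmetric sequence $M$ of $k$-modules is a family $(M(\ell))_{\ell\geq 0}$ of $k$-modules with a left $\Sigma_\ell$-action on $M(\ell)$. Their tensor product is $(M\odot N)(\ell)=\bigoplus_{p+q=\ell}k\Sigma_\ell\otimes_{k\Sigma_p\otimes k\Sigma_q}M(p)\otimes N(q)$, with unit $I$ given by $I(0)=k$, $I(\ell)=0$ for $\ell\neq 0$, and symmetry $tw[\sigma\otimes x\otimes y]=[(\sigma\circ\chi(q,p))\otimes y\otimes x]$ for $\sigma\in\Sigma_{p+q}$, $x\in M(p)$, $y\in N(q)$, where $\chi(q,p)(i)=i+p$ for $1\leq i\leq q$ and $\chi(q,p)(i)=i-q$ for $q<i\leq q+p$. A commutative shuffle algebra is a commutative monoid for $\odot$; write $\mu$ for its multiplication and $\mu(\sigma\otimes a\otimes b)\in A(p+q)$ for the image of $[\sigma\otimes a\otimes b]$. $A$ is augmented if it is equipped with a morphism of monoids $A\to I$. The condition $A(0)=k$ means that the unit $I\to A$ is an isomorphism in level $0$. $\mathrm{Sh}(p,q)\subset\Sigma_{p+q}$ is the set of $(p,q)$-shuffles, i.e. permutations $\sigma$ with $\sigma(1)<\dots<\sigma(p)$ and $\sigma(p+1)<\dots<\sigma(p+q)$. The graded module $\Psi(A)$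 is given by $\Psi(A)_n=0$ for $n$ odd and $\Psi(A)_{2m}=A(m)$, with the product $a\cdot b=\sum_{\sigma\in \mathrm{Sh}(p,q)}\mu(\sigma\otimes a\otimes b)$ for $a\in\Psi(A)_{2p}=A(p)$ and $b\in\Psi(A)_{2q}=A(q)$. A graded divided power algebra here means a graded commutative $k$-algebra $D$ (concentrated in even non-negative degrees) together with maps $\gamma_n\colon D_{2p}\to D_{2pn}$ for all $p>0$, $n\geq 0$ such that, for homogeneous elements $x,y$ of positive degree: $\gamma_0(x)=1$, $\gamma_1(x)=x$; $\gamma_n(x)\cdot\gamma_m(x)=\binom{n+m}{n}\gamma_{n+m}(x)$; $\gamma_n(x+y)=\sum_{i=0}^n\gamma_i(x)\cdot\gamma_{n-i}(y)$ for $x,y$ of the same degree; $\gamma_n(\gamma_m(x))=\frac{(nm)!}{n!(m!)^n}\gamma_{nm}(x)$ for $m\geq 1$; and $\gamma_n(x\cdot y)=x^n\cdot\gamma_n(y)$, the last one also for $x$ of degree $0$. *)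

(* Defs.v *)
From HB Require Import structures.
From mathcomp Require Import all_boot all_order all_algebra all_fingroup.
From mathcomp Require Import generic_quotient boolp.

Set Implicit Arguments.
Unset Strict Implicit.
Unset Printing Implicit Defensive.

Import GRing.Theory.
Local Open Scope ring_scope.
Local Open Scope quotient_scope.

(* Throughout, operations that land in degree p + q (or a similar expression)
   take as argument a proof e : p + q = l and land in degree l.  Since equality
   on nat is proof-irrelevant this carries the same information as landing in
   degree p + q, and no transport is needed to state associativity. *)

(* MathComp's product of permutations applies its left factor first;
   s \oP t is the usual composite, which applies t first. *)
Notation "s \oP t" := (t * s)%g (at level 40, left associativity).

Section BlockSum.
Variables (p q l : nat) (e : (p + q)%N = l).

Definition block_sum_fun (s : 'S_p) (t : 'S_q) (i : 'I_l) : 'I_l :=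
  cast_ord e (unsplit (match split (cast_ord (esym e) i) with
                       | inl j => inl (s j)
                       | inr j => inr (t j)
                       end)).

Lemma block_sum_funK (s : 'S_p) (t : 'S_q) :
  cancel (block_sum_fun s t) (block_sum_fun s^-1 t^-1).
Proof.
move=> i; rewrite /block_sum_fun cast_ordK unsplitK.
by rewrite -[RHS](cast_ordKV e) -[in RHS](splitK (cast_ord (esym e) i));
   case: split => j /=; rewrite permK.
Qed.

(* The image of (s, t) under the inclusion of S_p x S_q in S_(p+q). *)
Definition block_sum (s : 'S_p) (t : 'S_q) : 'S_l :=
  perm (can_inj (block_sum_funK s t)).

Lemma split_ordP (i : 'I_l) :
  (exists j : 'I_p, i = j :> nat) \/ (exists j : 'I_q, i = (p + j)%N :> nat).
Proof.
case: (ltnP i p) => h; first by left; exists (Ordinal h).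
have h' : (i - p < q)%N by rewrite ltn_subLR // e.
by right; exists (Ordinal h'); rewrite /= subnKC.
Qed.

Lemma block_sumL s t (i : 'I_l) (j : 'I_p) :
  i = j :> nat -> block_sum s t i = s j :> nat.
Proof.
move=> h; rewrite permE /block_sum_fun.
have -> : cast_ord (esym e) i = unsplit (inl j) by apply: val_inj.
by rewrite unsplitK.
Qed.

Lemma block_sumR s t (i : 'I_l) (j : 'I_q) :
  i = (p + j)%N :> nat -> block_sum s t i = (p + t j)%N :> nat.
Proof.
move=> h; rewrite permE /block_sum_fun.
have -> : cast_ord (esym e) i = unsplit (inr j) by apply: val_inj.
by rewrite unsplitK.
Qed.

Lemma block_sum1 : block_sum 1 1 = 1%g.
Proof.
apply/permP=> i; apply: val_inj; rewrite perm1.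
case: (split_ordP i) => -[j h].
  by rewrite /= (block_sumL _ _ h) perm1 h.
by rewrite /= (block_sumR _ _ h) perm1 h.
Qed.

Lemma block_sumM s s' t t' :
  block_sum (s \oP s') (t \oP t') = block_sum s t \oP block_sum s' t'.
Proof.
apply/permP=> i; apply: val_inj; rewrite permM.
case: (split_ordP i) => -[j h] /=.
  by rewrite (block_sumL _ _ h) (block_sumL _ _ (block_sumL _ _ h)) permM.
by rewrite (block_sumR _ _ h) (block_sumR _ _ (block_sumR _ _ h)) permM.
Qed.

End BlockSum.

Section Chi.
Variables (q p l : nat) (e : (q + p)%N = l).

Definition chi_fun (i : 'I_l) : 'I_l :=
  insubd i (if (i < q)%N then (i + p)%N else (i - q)%N).

Lemma chi_funE i : chi_fun i = (if (i < q)%N then i + p else i - q)%N :> nat.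
Proof.
suff h : ((if i < q then i + p else i - q) < l)%N by rewrite val_insubd h.
case: (ltnP i q) => h; first by rewrite -[X in (_ < X)%N]e ltn_add2r.
by rewrite (leq_ltn_trans (leq_subr _ _)).
Qed.

Lemma chi_inj : injective chi_fun.
Proof.
move=> i j /(congr1 val); rewrite /= !chi_funE => h; apply: val_inj => /=.
have bnd (i' : 'I_l) : (q <= i')%N -> (i' - q < p)%N.
  by move=> le; rewrite ltn_subLR // e.
move: h; case: (ltnP i q) => hi; case: (ltnP j q) => hj.
- exact: addIn.
- by move=> h; move: (bnd _ hj); rewrite -h ltnNge leq_addl.
- by move=> h; move: (bnd _ hi); rewrite h ltnNge leq_addl.
- by move=> h; rewrite -(subnK hi) h subnK.
Qed.

(* chi(q,p), with indices starting at 0. *)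
Definition chi : 'S_l := perm chi_inj.

Lemma chiE i : chi i = (if (i < q)%N then i + p else i - q)%N :> nat.
Proof. by rewrite permE chi_funE. Qed.

End Chi.

Lemma chi_block_sum p q l (e : (p + q)%N = l) (e' : (q + p)%N = l) s t :
  block_sum e s t \oP chi e' = chi e' \oP block_sum e' t s.
Proof.
apply/permP=> i; apply: val_inj; rewrite !permM /=.
case: (split_ordP e' i) => -[j h].
  have -> : (chi e' (block_sum e' t s i) = t j + p :> nat)%N.
    by rewrite chiE (block_sumL _ _ _ h) ltn_ord.
  rewrite [RHS]addnC; apply: block_sumR.
  by rewrite chiE h ltn_ord addnC.
have -> : (chi e' (block_sum e' t s i) = s j :> nat)%N.
  by rewrite chiE (block_sumR _ _ _ h) ltnNge leq_addr /= addKn.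
apply: block_sumL.
by rewrite chiE h ltnNge leq_addr /= addKn.
Qed.

Lemma assoc_deg p q r s l :
  (p + q)%N = s -> (s + r)%N = l -> (p + (q + r))%N = l.
Proof. by move=> <- <-; rewrite addnA. Qed.

Lemma block_sumA p q r s l (e1 : (p + q)%N = s) (e2 : (s + r)%N = l)
    (a : 'S_p) (b : 'S_q) (c : 'S_r) :
  block_sum e2 (block_sum e1 a b) c
  = block_sum (assoc_deg e1 e2) a (block_sum (erefl (q + r)%N) b c).
Proof.
apply/permP=> i; apply: val_inj => /=.
case: (split_ordP e2 i) => -[j h].
  rewrite (block_sumL _ _ _ h).
  case: (split_ordP e1 j) => -[j' h'].
    by rewrite (block_sumL _ _ _ h') (block_sumL _ _ _ (etrans h h')).
  have hj : (widen_ord (leq_addr r q) j' = j' :> nat) by [].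
  have hi : i = (p + widen_ord (leq_addr r q) j')%N :> nat by rewrite h h'.
  by rewrite (block_sumR _ _ _ h') (block_sumR _ _ _ hi) (block_sumL _ _ _ hj).
have hj : (rshift q j = q + j :> nat)%N by [].
have hi : i = (p + rshift q j)%N :> nat by rewrite h -e1 /= addnA.
by rewrite (block_sumR _ _ _ h) (block_sumR _ _ _ hi) (block_sumR _ _ _ hj)
           addnA e1.
Qed.

(* Indices start at 0, so the first block is 0, ..., p-1. *)
Definition shuffles p q l (e : (p + q)%N = l) : {set 'S_l} :=
  [set s : 'S_l | [forall i : 'I_l, forall j : 'I_l,
     [&& (i < j)%N & (j < p)%N || (p <= i)%N] ==> (s i < s j)%N]].

Record symseq (k : comPzRingType) := SymSeq {
  level :> nat -> lmodType k;
  sact : forall l, 'S_l -> {linear level l -> level l};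
  sact1 : forall l (x : level l), sact 1 x = x;
  sactM : forall l (s t : 'S_l) (x : level l), sact (s \oP t) x = sact s (sact t x)
}.
Arguments sact {k _ l} _.

Record symhom (k : comPzRingType) (M N : symseq k) := SymHom {
  hom :> forall l, {linear M l -> N l};
  hom_act : forall l (s : 'S_l) (x : M l), hom l (sact s x) = sact s (hom l x)
}.
Arguments hom {k M N} _ {l}.

Definition idhom (k : comPzRingType) (M : symseq k) : symhom M M :=
  @SymHom k M M (fun l => idfun) (fun l s x => erefl).

(* (M \odot N)(l) is presented by generators [s (x) x (x) y], for p + q = l,
   s in S_l, x in M(p) and y in N(q), and relations: it is the set of formal
   k-linear expressions in the generators modulo the congruence generated by
   the axioms of k-modules, bilinearity in (x, y), and the relations
   [s o (a (+) b) (x) x (x) y] = [s (x) a x (x) b y]. *)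
Section Tensor.
Variables (k : comPzRingType) (M N : symseq k) (l : nat).

Inductive texpr :=
  | TZero
  | TAdd of texpr & texpr
  | TOpp of texpr
  | TScale of k & texpr
  | TGen p q of (p + q)%N = l & 'S_l & M p & N q.

Inductive teq : texpr -> texpr -> Prop :=
  | teq_refl u : teq u u
  | teq_sym u v : teq u v -> teq v u
  | teq_trans u v w : teq u v -> teq v w -> teq u w
  | teq_add u u' v v' : teq u u' -> teq v v' -> teq (TAdd u v) (TAdd u' v')
  | teq_opp u u' : teq u u' -> teq (TOpp u) (TOpp u')
  | teq_scale a u u' : teq u u' -> teq (TScale a u) (TScale a u')
  | teq_addA u v w : teq (TAdd u (TAdd v w)) (TAdd (TAdd u v) w)
  | teq_addC u v : teq (TAdd u v) (TAdd v u)
  | teq_add0 u : teq (TAdd TZero u) u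
  | teq_addN u : teq (TAdd (TOpp u) u) TZero
  | teq_scaleA a b u : teq (TScale a (TScale b u)) (TScale (a * b) u)
  | teq_scale1 u : teq (TScale 1 u) u
  | teq_scaleDr a u v :
      teq (TScale a (TAdd u v)) (TAdd (TScale a u) (TScale a v))
  | teq_scaleDl a b u :
      teq (TScale (a + b) u) (TAdd (TScale a u) (TScale b u))
  | teq_genDl p q (e : (p + q)%N = l) s (x x' : M p) (y : N q) :
      teq (TGen e s (x + x') y) (TAdd (TGen e s x y) (TGen e s x' y))
  | teq_genDr p q (e : (p + q)%N = l) s (x : M p) (y y' : N q) :
      teq (TGen e s x (y + y')) (TAdd (TGen e s x y) (TGen e s x y'))
  | teq_genZl p q (e : (p + q)%N = l) s a (x : M p) (y : N q) :
      teq (TGen e s (a *: x) y) (TScale a (TGen e s x y))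
  | teq_genZr p q (e : (p + q)%N = l) s a (x : M p) (y : N q) :
      teq (TGen e s x (a *: y)) (TScale a (TGen e s x y))
  | teq_genP p q (e : (p + q)%N = l) s a b (x : M p) (y : N q) :
      teq (TGen e (s \oP block_sum e a b) x y) (TGen e s (sact a x) (sact b y)).

HB.instance Definition _ := gen_eqMixin texpr.
HB.instance Definition _ := gen_choiceMixin texpr.

Definition teqb (u v : texpr) : bool := `[< teq u v >].

Lemma teqb_equiv : equiv_class_of teqb.
Proof.
split.
- by move=> u; apply/asboolP; apply: teq_refl.
- by move=> u v; apply/asboolP/asboolP; apply: teq_sym.
- by move=> v u w /asboolP h /asboolP h'; apply/asboolP; apply: teq_trans h h'.
Qed.

Canonical teqb_rel := EquivRelPack teqb_equiv.

Definition tensor : Type := {eq_quot teqb_rel}.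
HB.instance Definition _ := Choice.on tensor.

Definition tclass (u : texpr) : tensor := \pi_({eq_quot teqb_rel}) u.

Lemma tclassP u v : teq u v <-> tclass u = tclass v.
Proof.
split=> [h|].
  by apply/eqmodP; apply/asboolP.
by move/eqmodP/asboolP.
Qed.

Definition trepr (x : tensor) : texpr := repr x.

Lemma treprK x : tclass (trepr x) = x.
Proof. exact: reprK. Qed.

Lemma teq_repr u : teq (trepr (tclass u)) u.
Proof. by apply/tclassP; rewrite treprK. Qed.

Definition tadd x y := tclass (TAdd (trepr x) (trepr y)).
Definition topp x := tclass (TOpp (trepr x)).
Definition tscale a x := tclass (TScale a (trepr x)).

Lemma taddE u v : tadd (tclass u) (tclass v) = tclass (TAdd u v).
Proof. by apply/tclassP; apply: teq_add; apply: teq_repr. Qed.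

Lemma toppE u : topp (tclass u) = tclass (TOpp u).
Proof. by apply/tclassP; apply: teq_opp; apply: teq_repr. Qed.

Lemma tscaleE a u : tscale a (tclass u) = tclass (TScale a u).
Proof. by apply/tclassP; apply: teq_scale; apply: teq_repr. Qed.

Lemma taddA : associative tadd.
Proof.
move=> x y z; rewrite -(treprK x) -(treprK y) -(treprK z) !taddE.
by apply/tclassP; apply: teq_addA.
Qed.

Lemma taddC : commutative tadd.
Proof. by move=> x y; apply/tclassP; apply: teq_addC. Qed.

Lemma tadd0 : left_id (tclass TZero) tadd.
Proof.
by move=> x; rewrite -(treprK x) taddE; apply/tclassP; apply: teq_add0.
Qed.

Lemma taddN : left_inverse (tclass TZero) topp tadd.
Proof.
by move=> x; rewrite -(treprK x) toppE taddE; apply/tclassP; apply: teq_addN.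
Qed.

HB.instance Definition _ := GRing.isZmodule.Build tensor taddA taddC tadd0 taddN.

Lemma tscaleA a b x : tscale a (tscale b x) = tscale (a * b) x.
Proof.
by rewrite -(treprK x) !tscaleE; apply/tclassP; apply: teq_scaleA.
Qed.

Lemma tscale1 : left_id 1 tscale.
Proof.
by move=> x; rewrite -(treprK x) !tscaleE; apply/tclassP; apply: teq_scale1.
Qed.

Lemma tscaleDr : right_distributive tscale +%R.
Proof.
move=> a x y; rewrite -(treprK x) -(treprK y).
rewrite [tclass _ + tclass _]taddE !tscaleE [RHS]taddE.
by apply/tclassP; apply: teq_scaleDr.
Qed.

Lemma tscaleDl x : {morph tscale^~ x : a b / a + b}.
Proof.
move=> a b; rewrite -(treprK x) !tscaleE [RHS]taddE.
by apply/tclassP; apply: teq_scaleDl.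
Qed.

HB.instance Definition _ := GRing.Zmodule_isLmodule.Build k tensor
  tscaleA tscale1 tscaleDr tscaleDl.

(* The class [s (x) x (x) y]. *)
Definition gen p q (e : (p + q)%N = l) (s : 'S_l) (x : M p) (y : N q) : tensor :=
  tclass (TGen e s x y).

Record balanced (V : lmodType k)
    (phi : forall p q, (p + q)%N = l -> 'S_l -> M p -> N q -> V) : Prop :=
  Balanced {
  balDl : forall p q (e : (p + q)%N = l) s x x' y,
    phi p q e s (x + x') y = phi p q e s x y + phi p q e s x' y;
  balDr : forall p q (e : (p + q)%N = l) s x y y',
    phi p q e s x (y + y') = phi p q e s x y + phi p q e s x y';
  balZl : forall p q (e : (p + q)%N = l) s a x y,
    phi p q e s (a *: x) y = a *: phi p q e s x y;
  balZr : forall p q (e : (p + q)%N = l) s a x y,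
    phi p q e s x (a *: y) = a *: phi p q e s x y;
  balP : forall p q (e : (p + q)%N = l) s a b x y,
    phi p q e (s \oP block_sum e a b) x y = phi p q e s (sact a x) (sact b y)
}.

Lemma gen_balanced : balanced gen.
Proof.
split=> *; rewrite /gen.
- by rewrite [RHS]taddE; apply/tclassP; apply: teq_genDl.
- by rewrite [RHS]taddE; apply/tclassP; apply: teq_genDr.
- by rewrite [RHS]tscaleE; apply/tclassP; apply: teq_genZl.
- by rewrite [RHS]tscaleE; apply/tclassP; apply: teq_genZr.
- by apply/tclassP; apply: teq_genP.
Qed.

Lemma tensor_ind (P : tensor -> Prop) :
  P 0 -> (forall u v, P u -> P v -> P (u + v)) ->
  (forall a u, P u -> P (a *: u)) ->
  (forall p q (e : (p + q)%N = l) s x y, P (gen e s x y)) ->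
  forall u, P u.
Proof.
move=> P0 PD PZ Pg u; rewrite -(treprK u); elim: (trepr u) => {u}//.
- by move=> u hu v hv; rewrite -taddE; apply: PD.
- by move=> u hu; rewrite -toppE -[topp _]/(- tclass u) -scaleN1r; apply: PZ.
- by move=> a u hu; rewrite -tscaleE; apply: PZ.
Qed.

Section Lift.
Variables (V : lmodType k)
  (phi : forall p q, (p + q)%N = l -> 'S_l -> M p -> N q -> V).

Fixpoint teval (u : texpr) : V :=
  match u with
  | TZero => 0
  | TAdd u v => teval u + teval v
  | TOpp u => - teval u
  | TScale a u => a *: teval u
  | TGen _ _ e s x y => phi e s x y
  end.

Definition lift_fun (x : tensor) : V := teval (trepr x).

Hypothesis bal : balanced phi.

Lemma tevalP u v : teq u v -> teval u = teval v.
Proof.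
elim=> //=.
- by move=> u' v' w' _ -> _ ->.
- by move=> u' v' w' t' _ -> _ ->.
- by move=> u' v' _ ->.
- by move=> a u' v' _ ->.
- by move=> *; rewrite addrA.
- by move=> *; rewrite addrC.
- by move=> *; rewrite add0r.
- by move=> *; rewrite addNr.
- by move=> *; rewrite scalerA.
- by move=> *; rewrite scale1r.
- by move=> *; rewrite scalerDr.
- by move=> *; rewrite scalerDl.
- by move=> *; rewrite (balDl bal).
- by move=> *; rewrite (balDr bal).
- by move=> *; rewrite (balZl bal).
- by move=> *; rewrite (balZr bal).
- by move=> *; rewrite (balP bal).
Qed.

Lemma lift_funE u : lift_fun (tclass u) = teval u.
Proof. by apply: tevalP; apply: teq_repr. Qed.

Lemma lift_linear : linear lift_fun.
Proof.
move=> a x y; rewrite -(treprK x) -(treprK y).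
by rewrite [a *: _]tscaleE [_ + _]taddE !lift_funE.
Qed.

Definition tensor_lift : {linear tensor -> V} :=
  let h := GRing.isLinear.Build k tensor V _ lift_fun lift_linear in
  HB.pack lift_fun h.

Lemma tensor_lift_gen p q (e : (p + q)%N = l) s x y :
  tensor_lift (gen e s x y) = phi e s x y.
Proof. by rewrite [LHS]lift_funE. Qed.

End Lift.

End Tensor.

Section TensorHom.
Variable k : comPzRingType.
Implicit Types M N P T : symseq k.

Lemma tensor_linear_ext M N l (V : lmodType k) (f g : {linear tensor M N l -> V}) :
  (forall p q (e : (p + q)%N = l) s (x : M p) (y : N q),
     f (gen e s x y) = g (gen e s x y)) -> f =1 g.
Proof.
move=> h; elim/tensor_ind => //.
- by rewrite !linear0.
- by move=> u v hu hv; rewrite !linearD hu hv.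
- by move=> a u hu; rewrite !linearZ_LR hu.
Qed.

Lemma tensor_act_bal M N l (t : 'S_l) :
  balanced (fun p q (e : (p + q)%N = l) s (x : M p) (y : N q) =>
              gen e (t \oP s) x y).
Proof.
have b := gen_balanced M N l.
split=> *; [exact: (balDl b) | exact: (balDr b) | exact: (balZl b)
           | exact: (balZr b) |].
by rewrite -(balP b) mulgA.
Qed.

Definition tensor_act M N l (t : 'S_l) : {linear tensor M N l -> tensor M N l} :=
  tensor_lift (tensor_act_bal M N t).
Local Arguments tensor_act {M N l} t.

Lemma tensor_act1 M N l (u : tensor M N l) : tensor_act 1 u = u.
Proof.
elim/tensor_ind: u => [|u v hu hv|a u hu|p q e s x y].
- by rewrite linear0.
- by rewrite linearD hu hv.
- by rewrite linearZ_LR hu.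
- by rewrite tensor_lift_gen mulg1.
Qed.

Lemma tensor_actM M N l (s t : 'S_l) (u : tensor M N l) :
  tensor_act (s \oP t) u = tensor_act s (tensor_act t u).
Proof.
elim/tensor_ind: u => [|u v hu hv|a u hu|p q e r x y].
- by rewrite !linear0.
- by rewrite !linearD hu hv.
- by rewrite !linearZ_LR hu.
- by rewrite !tensor_lift_gen mulgA.
Qed.

Definition odot M N : symseq k :=
  @SymSeq k (fun l => tensor M N l) (@tensor_act M N)
    (@tensor_act1 M N) (@tensor_actM M N).

Lemma act_gen M N l p q (e : (p + q)%N = l) (t s : 'S_l) (x : M p) (y : N q) :
  @sact k (odot M N) l t (gen e s x y) = gen e (t \oP s) x y.
Proof. by rewrite [LHS]tensor_lift_gen. Qed.

Lemma gen_act M N l p q (e : (p + q)%N = l) a b (x : M p) (y : N q) :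
  gen e 1 (sact a x) (sact b y)
  = @sact k (odot M N) l (block_sum e a b) (gen e 1 x y).
Proof. by rewrite act_gen -(balP (gen_balanced M N l)) mul1g mulg1. Qed.

Section LiftHom.
Variables (M N T : symseq k)
  (phi : forall l p q, (p + q)%N = l -> 'S_l -> M p -> N q -> T l).
Hypothesis bal : forall l, balanced (phi (l := l)).
Hypothesis eqv : forall l p q (e : (p + q)%N = l) t s x y,
  phi e (t \oP s) x y = sact t (phi e s x y).

Lemma lift_act l (s : 'S_l) (u : odot M N l) :
  tensor_lift (bal l) (sact s u) = sact s (tensor_lift (bal l) u).
Proof.
elim/tensor_ind: u => [|u v hu hv|a u hu|p q e r x y].
- by rewrite !linear0.
- by rewrite !linearD hu hv.
- by rewrite !linearZ_LR hu.
- by rewrite act_gen !tensor_lift_gen eqv.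
Qed.

(* The morphism M \odot N -> T sending [s (x) x (x) y] to phi e s x y. *)
Definition lift_hom : symhom (odot M N) T :=
  @SymHom k (odot M N) T (fun l => tensor_lift (bal l)) lift_act.

Lemma lift_homE l p q (e : (p + q)%N = l) s x y :
  lift_hom l (gen e s x y) = phi e s x y.
Proof. exact: tensor_lift_gen. Qed.

End LiftHom.

Section Map.
Variables (M M' N N' : symseq k) (f : symhom M M') (g : symhom N N').

Definition odot_map_gen l p q (e : (p + q)%N = l) (s : 'S_l) (x : M p) (y : N q)
  : odot M' N' l := gen e s (f p x) (g q y).

Lemma odot_map_bal l : balanced (@odot_map_gen l).
Proof.
have b := gen_balanced M' N' l.
split=> *; rewrite /odot_map_gen ?linearD ?linearZ_LR.
- exact: (balDl b).
- exact: (balDr b).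
- exact: (balZl b).
- exact: (balZr b).
- by rewrite !hom_act -(balP b).
Qed.

Lemma odot_map_eqv l p q (e : (p + q)%N = l) t s x y :
  odot_map_gen e (t \oP s) x y = sact t (odot_map_gen e s x y).
Proof. by rewrite act_gen. Qed.

Definition odot_map : symhom (odot M N) (odot M' N') :=
  lift_hom odot_map_bal odot_map_eqv.

Lemma odot_mapE l p q (e : (p + q)%N = l) (s : 'S_l) (x : M p) (y : N q) :
  odot_map l (gen e s x y) = gen e s (f p x) (g q y).
Proof. exact: lift_homE. Qed.

End Map.

Section Twist.
Variables M N : symseq k.

Definition twist_gen l p q (e : (p + q)%N = l) (s : 'S_l) (x : M p) (y : N q)
  : odot N M l :=
  let e' : (q + p)%N = l := etrans (addnC q p) e in
  gen e' (s \oP chi e') y x.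

Lemma twist_bal l : balanced (@twist_gen l).
Proof.
have b := gen_balanced N M l.
split=> *; rewrite /twist_gen.
- exact: (balDr b).
- exact: (balDl b).
- exact: (balZr b).
- exact: (balZl b).
- by rewrite -(balP b) !mulgA chi_block_sum.
Qed.

Lemma twist_eqv l p q (e : (p + q)%N = l) t s x y :
  twist_gen e (t \oP s) x y = sact t (twist_gen e s x y).
Proof. by rewrite /twist_gen act_gen mulgA. Qed.

Definition twist : symhom (odot M N) (odot N M) :=
  lift_hom twist_bal twist_eqv.

Lemma twistE l p q (e : (p + q)%N = l) (e' : (q + p)%N = l) (s : 'S_l)
    (x : M p) (y : N q) :
  twist l (gen e s x y) = gen e' (s \oP chi e') y x.
Proof. by rewrite [LHS]lift_homE /twist_gen (eq_irrelevance (etrans _ _) e'). Qed.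

End Twist.

(* The associator (M \odot N) \odot P -> M \odot (N \odot P), sending
   [s (x) [t (x) x (x) y] (x) z] to [s o (t (+) 1) (x) x (x) [1 (x) y (x) z]]. *)

Section Assoc.
Variables M N P : symseq k.

Section Inner.
Variables (m r l : nat) (e2 : (m + r)%N = l) (s : 'S_l) (z : P r).

Definition assoc_inner_gen p q (e1 : (p + q)%N = m) (t : 'S_m)
    (x : M p) (y : N q) : odot M (odot N P) l :=
  gen (N := odot N P) (assoc_deg e1 e2) (s \oP block_sum e2 t 1) x
      (gen (erefl (q + r)%N) 1 y z).

Lemma assoc_inner_bal : balanced assoc_inner_gen.
Proof.
have b := gen_balanced M (odot N P) l.
have b' n := gen_balanced N P n.
split=> *; rewrite /assoc_inner_gen.
- exact: (balDl b).
- by rewrite (balDl (b' _)) (balDr b).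
- exact: (balZl b).
- by rewrite (balZl (b' _)) (balZr b).
- by rewrite -[z in RHS]sact1 gen_act -(balP b) -block_sumA mulgA
             -block_sumM mulg1.
Qed.

Definition assoc_inner : {linear odot M N m -> odot M (odot N P) l} :=
  tensor_lift assoc_inner_bal.

End Inner.

Definition assoc_gen l m r (e2 : (m + r)%N = l) (s : 'S_l)
    (u : odot M N m) (z : P r) : odot M (odot N P) l :=
  assoc_inner e2 s z u.

Lemma assoc_bal l : balanced (@assoc_gen l).
Proof.
have b n := gen_balanced M (odot N P) n.
have b' n := gen_balanced N P n.
split=> [m r e s u u' z|m r e s u z z'|m r e s a u z|m r e s a u z|
         m r e s c d u z]; rewrite /assoc_gen.
- by rewrite linearD.
- elim/tensor_ind: u => [|u v hu hv|a u hu|p q e1 t x y].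
  + by rewrite !linear0 addr0.
  + by rewrite !linearD hu hv addrACA.
  + by rewrite !linearZ_LR hu scalerDr.
  + by rewrite !tensor_lift_gen /assoc_inner_gen (balDr (b' _)) (balDr (b _)).
- by rewrite linearZ_LR.
- elim/tensor_ind: u => [|u v hu hv|c u hu|p q e1 t x y].
  + by rewrite !linear0.
  + by rewrite !linearD hu hv.
  + by rewrite !(linearZ_LR (assoc_inner _ _ _)) hu !scalerA mulrC.
  + by rewrite !tensor_lift_gen /assoc_inner_gen (balZr (b' _)) (balZr (b _)).
- elim/tensor_ind: u => [|u v hu hv|a u hu|p q e1 t x y].
  + by rewrite !linear0.
  + by rewrite !linearD hu hv.
  + by rewrite !linearZ_LR hu.
  + rewrite act_gen !tensor_lift_gen /assoc_inner_gen.
    rewrite -[y in RHS]sact1 gen_act -[x in RHS]sact1 -(balP (b _)) -block_sumA.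
    by rewrite block_sum1 !mulgA -!block_sumM ?mulg1 ?mul1g.
Qed.

Lemma assoc_eqv l p q (e : (p + q)%N = l) t s x y :
  assoc_gen e (t \oP s) x y = sact t (assoc_gen e s x y).
Proof.
rewrite /assoc_gen; elim/tensor_ind: x => [|u v hu hv|a u hu|p' q' e1 r x z].
- by rewrite !linear0.
- by rewrite !linearD hu hv.
- by rewrite !linearZ_LR hu.
- by rewrite !tensor_lift_gen /assoc_inner_gen mulgA.
Qed.

Definition associator :
    symhom (odot (odot M N) P) (odot M (odot N P)) :=
  lift_hom assoc_bal assoc_eqv.

Lemma associatorE p q r m l (e1 : (p + q)%N = m) (e2 : (m + r)%N = l)
    (s : 'S_l) (t : 'S_m) (x : M p) (y : N q) (z : P r) :
  associator l (gen (M := odot M N) e2 s (gen e1 t x y) z)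
  = gen (N := odot N P) (assoc_deg e1 e2) (s \oP block_sum e2 t 1) x
        (gen (erefl (q + r)%N) 1 y z).
Proof. by rewrite [LHS]lift_homE /assoc_gen [LHS]tensor_lift_gen. Qed.

End Assoc.

Definition zero_module : lmodType k := 'rV[k]_0.

Lemma zero_moduleP (x y : zero_module) : x = y.
Proof. by rewrite [x]thinmx0 [y]thinmx0. Qed.

Definition unit_level (l : nat) : lmodType k :=
  if l is 0%N then k^o else zero_module.

Definition unitseq : symseq k :=
  @SymSeq k unit_level (fun l s => idfun) (fun l x => erefl) (fun l s t x => erefl).

Section Unitors.
Variable M : symseq k.

Definition transport i j (e : i = j) (x : M i) : M j := ecast n (M n) e x.

Lemma transport_id i (e : i = i) (x : M i) : transport e x = x.
Proof. by rewrite (eq_irrelevance e erefl). Qed.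

Lemma transport_comp i j n (e : i = j) (e' : j = n) (x : M i) :
  transport e' (transport e x) = transport (etrans e e') x.
Proof. by case: n / e'; rewrite transport_id. Qed.

Lemma act_block_sum0l q l (e : (0 + q)%N = l) (e' : q = l) a b (x : M q) :
  sact (block_sum e a b) (transport e' x) = transport e' (sact b x).
Proof.
case: l / e' e => e; rewrite !transport_id; congr (sact _ x).
by apply/permP=> i; apply: val_inj; rewrite /= (block_sumR _ _ _ (erefl (0 + i)%N)).
Qed.

Lemma act_block_sum0r p l (e : (p + 0)%N = l) (e' : p = l) a b (x : M p) :
  sact (block_sum e a b) (transport e' x) = transport e' (sact a x).
Proof.
case: l / e' e => e; rewrite !transport_id; congr (sact _ x).
by apply/permP=> i; apply: val_inj; rewrite /= (block_sumL _ _ _ (erefl (nat_of_ord i))).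
Qed.

(* I \odot M -> M sends [s (x) c (x) x] to c * (s x) for c in I(0) = k. *)
Definition lunit_gen l p q : (p + q)%N = l -> 'S_l -> unitseq p -> M q -> M l :=
  match p return (p + q)%N = l -> 'S_l -> unitseq p -> M q -> M l with
  | 0%N => fun e s c x => (c : k) *: sact s (transport e x)
  | _.+1 => fun _ _ _ _ => 0
  end.

Lemma lunit_bal l : balanced (@lunit_gen l).
Proof.
split=> -[|p] q e s; rewrite /= => *; rewrite ?addr0 ?scaler0 //.
- by rewrite scalerDl.
- by case: l / e s => s; rewrite linearD scalerDr.
- by rewrite scalerA.
- by case: l / e s => s; rewrite (linearZ_LR (sact _)) !scalerA mulrC.
- by rewrite sactM act_block_sum0l.
Qed.

Lemma lunit_eqv l p q (e : (p + q)%N = l) t s x y :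
  lunit_gen e (t \oP s) x y = sact t (lunit_gen e s x y).
Proof.
case: p e x => [|p] e x /=; last by rewrite linear0.
by rewrite (linearZ_LR (sact _)) sactM.
Qed.

Definition lunitor : symhom (odot unitseq M) M := lift_hom lunit_bal lunit_eqv.

Lemma lunitorE l q (e : (0 + q)%N = l) (s : 'S_l) (c : k) (x : M q) :
  lunitor l (gen (M := unitseq) (p := 0%N) e s c x) = c *: sact s (transport e x).
Proof. exact: lift_homE. Qed.

(* M \odot I -> M sends [s (x) x (x) c] to c * (s x) for c in I(0) = k. *)
Definition runit_gen l p q : (p + q)%N = l -> 'S_l -> M p -> unitseq q -> M l :=
  match q return (p + q)%N = l -> 'S_l -> M p -> unitseq q -> M l with
  | 0%N => fun e s x c =>
      (c : k) *: sact s (transport (etrans (esym (addn0 p)) e) x)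
  | _.+1 => fun _ _ _ _ => 0
  end.

Lemma runit_bal l : balanced (@runit_gen l).
Proof.
split=> p [|q] e s; rewrite /= => *; rewrite ?addr0 ?scaler0 //;
  try move: (etrans _ _) => e'.
- by case: l / e' e s => e s; rewrite !transport_id linearD scalerDr.
- by rewrite scalerDl.
- case: l / e' e s => e s; rewrite !transport_id (linearZ_LR (sact _)).
  by rewrite !scalerA mulrC.
- by rewrite scalerA.
- by rewrite sactM act_block_sum0r.
Qed.

Lemma runit_eqv l p q (e : (p + q)%N = l) t s x y :
  runit_gen e (t \oP s) x y = sact t (runit_gen e s x y).
Proof.
case: q e y => [|q] e y /=; last by rewrite linear0.
by rewrite (linearZ_LR (sact _)) sactM.
Qed.

Definition runitor : symhom (odot M unitseq) M := lift_hom runit_bal runit_eqv.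

Lemma runitorE l p (e : (p + 0)%N = l) (e' : p = l) (s : 'S_l) (x : M p) (c : k) :
  runitor l (gen (N := unitseq) (q := 0%N) e s x c) = c *: sact s (transport e' x).
Proof. by rewrite [LHS]lift_homE /= (eq_irrelevance (etrans _ _) e'). Qed.

End Unitors.

End TensorHom.

Notation "M \odot N" := (odot M N) (at level 40, left associativity).
Arguments unitseq k : clear implicits.

(* A monoid object for \odot, without its laws. *)
Record monoid_data (k : comPzRingType) := MonoidData {
  carrier :> symseq k;
  mu : symhom (carrier \odot carrier) carrier;
  eta : symhom (unitseq k) carrier
}.

Record commutative_shuffle_algebra (k : comPzRingType) (A : monoid_data k) : Prop :=
  CommutativeShuffleAlgebra {
  csa_assoc : forall l (u : ((A \odot A) \odot A) l),
    mu A l (odot_map (mu A) (idhom A) l u)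
    = mu A l (odot_map (idhom A) (mu A) l (associator A A A l u));
  csa_unitl : forall l (u : (unitseq k \odot A) l),
    mu A l (odot_map (eta A) (idhom A) l u) = lunitor A l u;
  csa_unitr : forall l (u : (A \odot unitseq k) l),
    mu A l (odot_map (idhom A) (eta A) l u) = runitor A l u;
  csa_comm : forall l (u : (A \odot A) l),
    mu A l (twist A A l u) = mu A l u
}.

Record is_monoid_hom (k : comPzRingType) (A B : monoid_data k)
    (f : symhom A B) : Prop := IsMonoidHom {
  mm_mul : forall l (u : (A \odot A) l), f l (mu A l u) = mu B l (odot_map f f l u);
  mm_unit : forall l (c : unitseq k l), f l (eta A l c) = eta B l c
}.

Arguments is_monoid_hom {k} A B f.

Definition unit_monoid (k : comPzRingType) : monoid_data k :=
  MonoidData (lunitor (unitseq k)) (idhom (unitseq k)).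

(* A graded module with a unit and a product, without the algebra laws. *)
Record graded_data (k : comPzRingType) := GradedData {
  degree :> nat -> lmodType k;
  gone : degree 0%N;
  gmul : forall m n l, (m + n)%N = l -> degree m -> degree n -> degree l
}.
Arguments gone {k} D : rename.
Arguments gmul {k D m n l} e x y : rename.

Record graded_commutative_algebra (k : comPzRingType) (D : graded_data k) : Prop :=
  GradedCommutativeAlgebra {
  gmulDl : forall m n l (e : (m + n)%N = l) (x x' : D m) (y : D n),
    gmul e (x + x') y = gmul e x y + gmul e x' y;
  gmulDr : forall m n l (e : (m + n)%N = l) (x : D m) (y y' : D n),
    gmul e x (y + y') = gmul e x y + gmul e x y';
  gmulZl : forall m n l (e : (m + n)%N = l) (a : k) (x : D m) (y : D n),
    gmul e (a *: x) y = a *: gmul e x y;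
  gmulZr : forall m n l (e : (m + n)%N = l) (a : k) (x : D m) (y : D n),
    gmul e x (a *: y) = a *: gmul e x y;
  gmulA : forall m n r s t l (emn : (m + n)%N = s) (esr : (s + r)%N = l)
      (enr : (n + r)%N = t) (emt : (m + t)%N = l) (x : D m) (y : D n) (z : D r),
    gmul esr (gmul emn x y) z = gmul emt x (gmul enr y z);
  gmul1l : forall n (e : (0 + n)%N = n) (x : D n), gmul e (gone D) x = x;
  gmul1r : forall n (e : (n + 0)%N = n) (x : D n), gmul e x (gone D) = x;
  gmulC : forall m n l (e : (m + n)%N = l) (e' : (n + m)%N = l)
      (x : D m) (y : D n),
    gmul e x y = (-1) ^+ (m * n) *: gmul e' y x
}.

Definition concentrated_in_even_degrees (k : comPzRingType) (D : graded_data k) :=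
  forall n, odd n -> forall x : D n, x = 0.

Fixpoint gpow (k : comPzRingType) (D : graded_data k) d (x : D d) n :
    D (n * d)%N :=
  match n return D (n * d)%N with
  | 0%N => gone D
  | n'.+1 => gmul (erefl (d + n' * d)%N) x (gpow x n')
  end.

Lemma gamma_sum_deg n d l (i : 'I_n.+1) :
  (n * d)%N = l -> (i * d + (n - i) * d)%N = l.
Proof. by move=> <-; rewrite -mulnDl subnKC // -ltnS. Qed.

(* gamma n p l e is the map gamma_n from degree 2p to degree l = n(2p); only
   its values for p > 0 are constrained. *)
Record divided_powers (k : comPzRingType) (D : graded_data k)
    (gamma : forall n p l, (n * p.*2)%N = l -> D p.*2 -> D l) : Prop :=
  DividedPowers {
  dp_0 : forall p (e : (0 * p.*2)%N = 0%N) (x : D p.*2), (0 < p)%N ->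
    gamma 0%N p 0%N e x = gone D;
  dp_1 : forall p (e : (1 * p.*2)%N = p.*2) (x : D p.*2), (0 < p)%N ->
    gamma 1%N p p.*2 e x = x;
  dp_mul : forall p n m a b l (ea : (n * p.*2)%N = a) (eb : (m * p.*2)%N = b)
      (eab : (a + b)%N = l) (el : ((n + m) * p.*2)%N = l) (x : D p.*2),
    (0 < p)%N ->
    gmul eab (gamma n p a ea x) (gamma m p b eb x)
    = gamma (n + m)%N p l el x *+ 'C(n + m, n);
  dp_add : forall p n l (e : (n * p.*2)%N = l) (x y : D p.*2), (0 < p)%N ->
    gamma n p l e (x + y)
    = \sum_(i < n.+1) gmul (gamma_sum_deg i e)
                           (gamma i p _ (erefl (i * p.*2)%N) x)
                           (gamma (n - i)%N p _ (erefl ((n - i) * p.*2)%N) y);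
  dp_comp : forall p n m r l (e1 : (m * p.*2)%N = r.*2) (e2 : (n * r.*2)%N = l)
      (e3 : (n * m * p.*2)%N = l) (x : D p.*2), (0 < p)%N -> (0 < m)%N ->
    gamma n r l e2 (gamma m p r.*2 e1 x)
    = gamma (n * m)%N p l e3 x *+ ((n * m)`! %/ (n`! * m`! ^ n));
  dp_prod : forall p q r n l (e : (p.*2 + q.*2)%N = r.*2)
      (e1 : (n * r.*2)%N = l) (e2 : (n * p.*2 + n * q.*2)%N = l)
      (x : D p.*2) (y : D q.*2), (0 < q)%N ->
    gamma n r l e1 (gmul e x y)
    = gmul e2 (gpow x n) (gamma n q _ (erefl (n * q.*2)%N) y)
}.

Definition divided_power_algebra (k : comPzRingType) (D : graded_data k) : Prop :=
  [/\ graded_commutative_algebra D,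
      concentrated_in_even_degrees D &
      exists gamma : forall n p l, (n * p.*2)%N = l -> D p.*2 -> D l,
        divided_powers gamma].

Section Psi.
Variables (k : comPzRingType) (A : monoid_data k).

Definition Psi_level (n : nat) : lmodType k :=
  if odd n then zero_module k else A n./2.

Definition Psi_out n : Psi_level n -> A n./2 :=
  match odd n as b
    return ((if b then zero_module k else A n./2) : lmodType k) -> A n./2 with
  | true => fun=> 0
  | false => id
  end.

Definition Psi_in n : A n./2 -> Psi_level n :=
  match odd n as b
    return A n./2 -> ((if b then zero_module k else A n./2) : lmodType k) with
  | true => fun=> 0
  | false => id
  end.

Definition shuffle_product p q l (e : (p + q)%N = l) (a : A p) (b : A q) : A l :=
  \sum_(s in shuffles e) mu A l (gen e s a b).

(* The two halves fail to add up to l./2 only when m and n are both odd, in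
   which case both factors are zero. *)
Definition Psi_mul m n l (e : (m + n)%N = l) (a : Psi_level m) (b : Psi_level n)
    : Psi_level l :=
  match (m./2 + n./2)%N =P l./2 with
  | ReflectT e' => Psi_in (shuffle_product e' (Psi_out a) (Psi_out b))
  | ReflectF _ => 0
  end.

Definition Psi : graded_data k :=
  @GradedData k Psi_level (eta A 0%N (1 : k)) Psi_mul.

(* Psi_even identifies A(m) with Psi(A)_2m, and under this identification the
   product of Psi(A) is the shuffle product. *)
Definition Psi_even m (a : A m) : Psi m.*2 :=
  Psi_in (transport (esym (doubleK m)) a).

Lemma Psi_inK n : ~~ odd n -> cancel (@Psi_in n) (@Psi_out n).
Proof. by rewrite /Psi_in /Psi_out /Psi_level => + x; case: (odd n). Qed.

Lemma Psi_outK n : ~~ odd n -> cancel (@Psi_out n) (@Psi_in n).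
Proof. by rewrite /Psi_in /Psi_out /Psi_level; case: (odd n). Qed.

Lemma Psi_even_bij m : bijective (@Psi_even m).
Proof.
exists (fun x => transport (doubleK m) (Psi_out x)) => x; rewrite /Psi_even.
  by rewrite Psi_inK ?odd_double // transport_comp transport_id.
by rewrite transport_comp transport_id Psi_outK ?odd_double.
Qed.

Lemma Psi_mulE p q l (e : (p + q)%N = l) (e' : (p.*2 + q.*2)%N = l.*2)
    (a : A p) (b : A q) :
  gmul (D := Psi) e' (Psi_even a) (Psi_even b) = Psi_even (shuffle_product e a b).
Proof.
rewrite /= /Psi_mul; case: eqP => [h|[]]; last by rewrite !doubleK.
congr Psi_in; rewrite /Psi_even !Psi_inK ?odd_double //.
move: h; set ep := esym (doubleK p); set eq := esym (doubleK q).
set el := esym (doubleK l).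
move: (p.*2./2) (q.*2./2) (l.*2./2) ep eq el => p' q' l' ep eq el.
case: p' / ep; case: q' / eq; case: l' / el => h.
by rewrite !transport_id (eq_irrelevance h e).
Qed.

End Psi.

(* Main.v *)
From HB Require Import structures.
From mathcomp Require Import all_boot all_order all_algebra all_fingroup.
From mathcomp Require Import boolp ring.
Require Import Defs.

(** Let B_N be the ring of functions f assigning to each subset S of {0..N-1} an
    element of A(|S|), with (f g)(U) the sum over U = S + T (disjoint) of the
    products f(S) g(T), placed in A(|U|) by the shuffle that merges S and T.
    It is commutative because A is, and an element a of A(p) gives the function
    with value a on the p-element sets; this turns the shuffle product into the
    product of B_N.  If f(0) = 0, then f is the sum of its components f_S, which
    have square zero, and gamma_n f is the n-th elementary symmetric polynomial
    in the f_S, i.e. the coefficient of X^n in E(f) = prod_S (1 + f_S X).  The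
    divided power axioms follow from two facts: E(f + g) = E(f) E(g), and
    E(w) = 1 + w X for w supported on a single set.  Restriction along increasing
    maps {0..M-1} -> {0..N-1} is a ring morphism that commutes with gamma_n, so
    gamma_n of a constant function is again constant, i.e. comes from A(np). *)

Set Implicit Arguments.
Unset Strict Implicit.
Unset Printing Implicit Defensive.

Import GRing.Theory.
Local Open Scope ring_scope.

(** * Elementary symmetric polynomials *)

Section ElementarySymmetric.
Variable R : comNzRingType.

Definition esym_poly (I : Type) (r : seq I) (x : I -> R) : {poly R} :=
  \prod_(i <- r) (1 + (x i)%:P * 'X).

(** The recurrence e_n(a, x) = e_n(x) + a e_(n-1)(x) for elementary symmetric polynomials, on which
    most inductions over the list of variables rest; the [if] encodes e_(-1) = 0. *)
Lemma coef_linear_mul (a : R) (p : {poly R}) n :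
  ((1 + a%:P * 'X) * p)`_n = p`_n + a * (if n is n'.+1 then p`_n' else 0).
Proof.
rewrite mulrDl mul1r -mulrA coefD coefCM -commr_polyX coefMX.
by case: n.
Qed.

Lemma esym_poly_nil (I : Type) (x : I -> R) : esym_poly [::] x = 1.
Proof. exact: big_nil. Qed.

Lemma esym_poly_cons (I : Type) i (r : seq I) (x : I -> R) :
  esym_poly (i :: r) x = (1 + (x i)%:P * 'X) * esym_poly r x.
Proof. exact: big_cons. Qed.

Lemma esym_poly0 (I : Type) (r : seq I) (x : I -> R) : (esym_poly r x)`_0 = 1.
Proof.
elim: r => [|i r IH]; first by rewrite esym_poly_nil coef1.
by rewrite esym_poly_cons coef_linear_mul mulr0 addr0.
Qed.

Lemma esym_poly1 (I : Type) (r : seq I) (x : I -> R) :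
  (esym_poly r x)`_1 = \sum_(i <- r) x i.
Proof.
elim: r => [|i r IH]; first by rewrite !esym_poly_nil ?big_nil coef1.
by rewrite esym_poly_cons coef_linear_mul esym_poly0 mulr1 IH big_cons addrC.
Qed.

(** Squares vanish, so only products of distinct variables survive, and each product of n + m of
    them arises from C(n + m, n) pairs. The induction turns this count into Pascal's rule. *)
Lemma esym_polyM (I : Type) (r : seq I) (x : I -> R) n m :
  (forall i, x i * x i = 0) ->
  (esym_poly r x)`_n * (esym_poly r x)`_m
  = (esym_poly r x)`_(n + m) *+ 'C(n + m, n).
Proof.
move=> x2; elim: r n m => [|i r IH] n m.
  rewrite esym_poly_nil !coef1; case: n m => [|n] [|m].
  - by rewrite bin0 mulr1.
  - by rewrite mulr0 mul0rn.
  - by rewrite mul0r mul0rn.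
  - by rewrite mul0r mul0rn.
rewrite esym_poly_cons !coef_linear_mul; case: n m => [|n] [|m].
- by rewrite !mulr0 !addr0 esym_poly0 mulr1 bin0.
- by rewrite mulr0 addr0 esym_poly0 mul1r add0n bin0 mulr1n.
- by rewrite mulr0 addr0 esym_poly0 mulr1 addn0 binn mulr1n.
set a := x i; set p := esym_poly r x.
have -> : (p`_n.+1 + a * p`_n) * (p`_m.+1 + a * p`_m)
  = p`_n.+1 * p`_m.+1 + a * (p`_n * p`_m.+1 + p`_n.+1 * p`_m)
    + (a * a) * (p`_n * p`_m) by ring.
rewrite x2 mul0r addr0 !IH addnS !addSn addnS /= binS.
by rewrite mulrnDl -/p -[X in _ + a * X]mulrnDr mulrnAr [X in _ + _ *+ X]addnC.
Qed.

Lemma esym_poly_add (I : Type) (r : seq I) (x y : I -> R) :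
  (forall i, x i * y i = 0) ->
  esym_poly r (fun i => x i + y i) = esym_poly r x * esym_poly r y.
Proof.
move=> xy; rewrite /esym_poly -big_split; apply: eq_bigr => i _ /=.
have -> : (1 + (x i)%:P * 'X) * (1 + (y i)%:P * 'X)
  = 1 + ((x i)%:P + (y i)%:P) * 'X + (x i)%:P * (y i)%:P * 'X * 'X :> {poly R}
  by ring.
by rewrite -polyCM xy mul0r mul0r addr0 polyCD.
Qed.

Lemma esym_poly_scale (I : Type) (r : seq I) (c : R) (x : I -> R) n :
  (esym_poly r (fun i => c * x i))`_n = c ^+ n * (esym_poly r x)`_n.
Proof.
elim: r n => [|i r IH] n.
  rewrite !esym_poly_nil ?big_nil coef1.
  by case: n => [|n]; rewrite ?expr0 ?mulr1 ?mulr0.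
rewrite !esym_poly_cons !coef_linear_mul IH mulrDr; congr (_ + _).
by case: n => [|n]; rewrite ?mulr0 // IH exprS; ring.
Qed.

(** The hypothesis includes i = j, so every coefficient beyond degree 1 is a sum of zero
    products. *)
Lemma esym_poly_ortho (I : Type) (r : seq I) (x : I -> R) :
  (forall i j, x i * x j = 0) ->
  esym_poly r x = 1 + (\sum_(i <- r) x i)%:P * 'X.
Proof.
move=> xx; elim: r => [|i r IH].
  by rewrite !esym_poly_nil ?big_nil mul0r addr0.
rewrite esym_poly_cons IH big_cons polyCD.
set s := \sum_(j <- r) x j.
have -> : (1 + (x i)%:P * 'X) * (1 + s%:P * 'X)
  = 1 + ((x i)%:P + s%:P) * 'X + ((x i)%:P * s%:P) * 'X * 'X :> {poly R} by ring.
by rewrite -polyCM mulr_sumr big1 ?mul0r ?addr0.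
Qed.

End ElementarySymmetric.

(* The number of partitions of a set of n * m elements into n blocks of size m. *)
Definition block_partitions (n m : nat) : nat := ((n * m)`! %/ (n`! * m`! ^ n))%N.

Lemma block_partitions0 m : block_partitions 0 m = 1%N.
Proof. by rewrite /block_partitions mul0n fact0 expn0. Qed.

(** Division-free count: the block of one fixed element is determined by the n'm elements that it
    leaves, out of the n'm + m - 1 others, to the remaining n' blocks. *)
Fixpoint block_partitions_rec (n m : nat) : nat :=
  if n is n'.+1
  then (block_partitions_rec n' m * 'C(n' * m + m.-1, n' * m))%N else 1%N.

Lemma block_partitions_recE n m : (0 < m)%N ->
  (block_partitions_rec n m * (n`! * m`! ^ n))%N = (n * m)`!.
Proof.
case: m => // m _; elim: n => [|n IH] /=; first by rewrite fact0 expn0.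
rewrite [in RHS]mulSn [in RHS]addSn [in RHS]factS (addnC m).
rewrite -(bin_fact (leq_addr m (n * m.+1))) addKn -IH factS expnS.
rewrite [m.+1`!]factS.
(* The leading factor of the factorial supplies the new factors [n.+1] and [m.+1] of the two
   factorials on the other side. *)
have -> : ((n * m.+1 + m).+1 = n.+1 * m.+1)%N by rewrite mulSn addSn addnC.
ring.
Qed.

Lemma block_partitionsE n m : (0 < m)%N ->
  block_partitions n m = block_partitions_rec n m.
Proof.
move=> m0; rewrite /block_partitions -block_partitions_recE // mulnK //.
by rewrite muln_gt0 expn_gt0 !fact_gt0.
Qed.

Lemma block_partitionsS n m :
  (block_partitions n.+1 m.+1
   = block_partitions n m.+1 * 'C(n * m.+1 + m, n * m.+1))%N.
Proof. by rewrite !block_partitionsE. Qed.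

(** * Concatenated labellings and the multiplication of A *)

Section Join.
Variable I : Type.

(** Permutations are compared below by composing them with injective labellings; joins describe such
    composites with block sums and [chi]. *)
Definition join p q l (e : (p + q)%N = l) (f : 'I_p -> I) (g : 'I_q -> I)
    (i : 'I_l) : I :=
  match split (cast_ord (esym e) i) with inl j => f j | inr j => g j end.

Lemma joinL p q l (e : (p + q)%N = l) (f : 'I_p -> I) (g : 'I_q -> I)
    (i : 'I_l) (j : 'I_p) : i = j :> nat -> join e f g i = f j.
Proof.
move=> h; rewrite /join.
have -> : cast_ord (esym e) i = unsplit (inl j) by apply: val_inj.
by rewrite unsplitK.
Qed.

Lemma joinR p q l (e : (p + q)%N = l) (f : 'I_p -> I) (g : 'I_q -> I)
    (i : 'I_l) (j : 'I_q) : i = (p + j)%N :> nat -> join e f g i = g j.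
Proof.
move=> h; rewrite /join.
have -> : cast_ord (esym e) i = unsplit (inr j) by apply: val_inj.
by rewrite unsplitK.
Qed.

Lemma join_chi p q l (e : (p + q)%N = l) (e' : (q + p)%N = l)
    (f : 'I_p -> I) (g : 'I_q -> I) i :
  join e f g (chi e' i) = join e' g f i.
Proof.
case: (split_ordP e' i) => -[j h].
  rewrite (joinL _ _ _ h); apply: joinR.
  by rewrite chiE h ltn_ord addnC.
rewrite (joinR _ _ _ h); apply: joinL.
by rewrite chiE h ltnNge leq_addr /= addKn.
Qed.

Lemma join_block_sum p q l (e : (p + q)%N = l)
    (f : 'I_p -> I) (g : 'I_q -> I) s t i :
  join e f g (block_sum e s t i) = join e (f \o s) (g \o t) i.
Proof.
case: (split_ordP e i) => -[j h].
  by rewrite (joinL _ _ _ h) (joinL _ _ _ (block_sumL _ _ _ h)).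
by rewrite (joinR _ _ _ h) (joinR _ _ _ (block_sumR _ _ _ h)).
Qed.

Lemma eq_join p q l (e : (p + q)%N = l) (f f' : 'I_p -> I) (g g' : 'I_q -> I) :
  f =1 f' -> g =1 g' -> join e f g =1 join e f' g'.
Proof. by move=> hf hg i; rewrite /join; case: split. Qed.

Lemma joinA p q r s t l (e1 : (p + q)%N = s) (e2 : (s + r)%N = l)
    (e3 : (p + t)%N = l) (e4 : (q + r)%N = t)
    (f : 'I_p -> I) (g : 'I_q -> I) (h : 'I_r -> I) :
  join e2 (join e1 f g) h =1 join e3 f (join e4 g h).
Proof.
move=> i; case: (split_ordP e2 i) => -[j hi].
  rewrite (joinL _ _ _ hi); case: (split_ordP e1 j) => -[j' hj].
    by rewrite (joinL _ _ _ hj) (joinL _ _ _ (etrans hi hj)).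
  have lt : (j' < t)%N by rewrite -e4 ltn_addr.
  rewrite (joinR _ _ _ hj) (joinR _ _ _ (j := Ordinal lt)) ?hi ?hj //.
  by rewrite (joinL _ _ _ (j := j')).
have lt : (q + j < t)%N by rewrite -e4 ltn_add2l.
rewrite (joinR _ _ _ hi) (joinR _ _ _ (j := Ordinal lt)) ?hi -?e1 ?addnA //.
by rewrite (joinR _ _ _ (j := j)).
Qed.

End Join.

Lemma factor_perm (I : finType) l (f g : 'I_l -> I) :
  injective f -> (forall i, f i \in codom g) ->
  exists s : 'S_l, forall i, g (s i) = f i.
Proof.
move=> finj fg; pose h i := iinv (fg i).
have gh i : g (h i) = f i by exact: f_iinv.
have hinj : injective h by move=> i j /(congr1 g); rewrite !gh => /finj.
by exists (perm hinj) => i; rewrite permE.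
Qed.

Section Transport.
Variables (k : comPzRingType) (M : symseq k) (i j : nat) (e : i = j).

Lemma transport0 : transport e (0 : M i) = 0.
Proof. by case: j / e. Qed.

Lemma transportD (x y : M i) :
  transport e (x + y) = transport e x + transport e y.
Proof. by case: j / e. Qed.

Lemma transportZ c (x : M i) : transport e (c *: x) = c *: transport e x.
Proof. by case: j / e. Qed.

Lemma transport_sum (J : Type) (r : seq J) (P : pred J) (F : J -> M i) :
  transport e (\sum_(x <- r | P x) F x) = \sum_(x <- r | P x) transport e (F x).
Proof. by case: j / e. Qed.

Lemma transport_irr (e' : i = j) (x : M i) : transport e x = transport e' x.
Proof. by rewrite (eq_irrelevance e e'). Qed.

Lemma transportK : cancel (@transport k M i j e) (transport (esym e)).
Proof. by case: j / e. Qed.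

Lemma transport_eq0 (x : M i) : transport e x = 0 -> x = 0.
Proof. by case: j / e. Qed.

End Transport.

Section Multiplication.
Variables (k : comPzRingType) (A : monoid_data k).
Hypothesis hA : commutative_shuffle_algebra A.

Lemma mu_C p q l (e : (p + q)%N = l) (e' : (q + p)%N = l) s
    (a : A p) (b : A q) :
  mu A l (gen e s a b) = mu A l (gen e' (s \oP chi e') b a).
Proof. by rewrite -(csa_comm hA) (twistE e e'). Qed.

(** The inner permutation [t'] is moved outside by equivariance of [mu] and the balancing relation,
    so that associativity reduces to an equality of two composite permutations. *)
Lemma mu_A p q r m n l (e1 : (p + q)%N = m) (e2 : (m + r)%N = l)
    (e3 : (p + n)%N = l) (e4 : (q + r)%N = n) s t s' t'
    (a : A p) (b : A q) (c : A r) :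
  s \oP block_sum e2 t 1 = s' \oP block_sum e3 1 t' ->
  mu A l (gen e2 s (mu A m (gen e1 t a b)) c)
  = mu A l (gen e3 s' a (mu A n (gen e4 t' b c))).
Proof.
move=> h; have := csa_assoc hA (gen (M := A \odot A) e2 s (gen e1 t a b) c).
rewrite associatorE !odot_mapE /= h => ->.
case: n / e4 e3 t' h => e3 t' h; rewrite (eq_irrelevance (assoc_deg e1 e2) e3).
by rewrite (balP (gen_balanced A A l)) sact1 -(hom_act (mu A)) act_gen mul1g.
Qed.

Lemma mu_1l q l (e : (0 + q)%N = l) (e' : q = l) s (c : k) (b : A q) :
  mu A l (gen e s (eta A 0%N (c : unitseq k 0%N)) b) = c *: sact s (transport e' b).
Proof.
have := csa_unitl hA (gen (M := unitseq k) (p := 0%N) e s c b).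
have -> : e' = (e : q = l) by exact: eq_irrelevance.
by rewrite odot_mapE lunitorE.
Qed.

End Multiplication.

(** * Subsets and shuffles *)

Section Enumeration.
Variable N : nat.
Implicit Types S T U : {set 'I_N}.

Definition ev S : 'I_#|S| -> 'I_N := @enum_val _ (mem S).

Lemma ev_inj S : injective (@ev S).
Proof. exact: enum_val_inj. Qed.

Lemma ev_in S i : @ev S i \in S.
Proof. exact: enum_valP. Qed.

Lemma ev_surj S x : x \in S -> exists i, ev (S := S) i = x.
Proof. by move=> xS; exists (enum_rank_in xS x); rewrite /ev enum_rankK_in. Qed.

Lemma enum_set_sorted S : sorted ltn (map val (enum S)).
Proof.
rewrite sorted_map /enum_mem; apply: sorted_filter.
  by move=> x y z; apply: ltn_trans.
by rewrite -enumT -sorted_map val_enum_ord iota_ltn_sorted.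
Qed.

(** An increasing enumeration of a finite set is unique: two strictly sorted lists with the same
    elements coincide. *)
Lemma mono_enum p (f : 'I_p -> 'I_N) S :
  (forall i j : 'I_p, (i < j)%N -> (f i < f j)%N) ->
  (forall x, reflect (exists i, f i = x) (x \in S)) ->
  exists e : p = #|S|, forall i, f i = ev (cast_ord e i).
Proof.
move=> fm fS.
have h : map f (enum 'I_p) = enum S.
  apply: (inj_map val_inj).
  apply: (irr_sorted_eq ltn_trans ltnn _ (enum_set_sorted S)).
    rewrite -map_comp sorted_map.
    have := iota_ltn_sorted 0 p; rewrite -val_enum_ord sorted_map.
    by apply: sub_sorted => i j; apply: fm.
  move=> x; apply/mapP/mapP => -[y].
    by case/mapP => i _ -> ->; exists (f i); rewrite // mem_enum; apply/fS; exists i.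
  rewrite mem_enum => /fS [i <-] ->; exists (f i) => //.
  by apply: map_f; rewrite mem_enum.
have e : p = #|S| by rewrite cardE -h size_map size_enum_ord.
exists e => i; rewrite /ev (enum_val_nth (f i)) -h (nth_map i) ?size_enum_ord //.
  by rewrite /= nth_ord_enum.
exact: (ltn_ord i).
Qed.

Lemma ev_mono S (i j : 'I_#|S|) : (i < j)%N -> (ev i < ev j)%N.
Proof.
move=> ij; rewrite /ev !(enum_val_nth (ev i)).
have := enum_set_sorted S; rewrite sorted_map.
have tr : transitive (relpre val ltn : rel 'I_N) by move=> x y z; apply: ltn_trans.
move/(sorted_ltn_nth tr (ev i)); apply=> //; by rewrite inE -cardE.
Qed.

Definition split_set S T U := [disjoint S & T] && (S :|: T == U).

Lemma split_setC S T U : split_set S T U = split_set T S U.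
Proof. by rewrite /split_set disjoint_sym setUC. Qed.

Lemma split_setD S U : S \subset U -> split_set S (U :\: S) U.
Proof.
move=> sSU; rewrite /split_set -setI_eq0; apply/andP; split; apply/eqP/setP=> x.
  by rewrite !inE andbA andbN.
by rewrite !inE; have /implyP := subsetP sSU x; do 2!case: (_ \in _).
Qed.

(** Since [ev] is increasing and injective, [s] is the unique shuffle that merges [S] and [T] into
    [U]. *)
Definition splits S T U (e : (#|S| + #|T|)%N = #|U|) (s : 'S_#|U|) :=
  forall i, ev (s i) = join e (@ev S) (@ev T) i.

Lemma splits_exist S T U : split_set S T U ->
  exists (e : (#|S| + #|T|)%N = #|U|) s, splits e s.
Proof.
case/andP=> d /eqP hU.
have e : (#|S| + #|T|)%N = #|U|.
  by rewrite -hU cardsU; move: d; rewrite -setI_eq0 => /eqP ->; rewrite cards0 subn0.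
exists e; apply: factor_perm.
  move=> i j; case: (split_ordP e i) => -[i' hi]; case: (split_ordP e j) => -[j' hj].
  - rewrite !(joinL _ _ _ hi) !(joinL _ _ _ hj) => /ev_inj h.
    by apply: val_inj; rewrite /= hi hj h.
  - rewrite !(joinL _ _ _ hi) !(joinR _ _ _ hj) => h.
    by have := ev_in i'; rewrite h => /(disjointFr d); rewrite ev_in.
  - rewrite !(joinR _ _ _ hi) !(joinL _ _ _ hj) => h.
    by have := ev_in j'; rewrite -h => /(disjointFr d); rewrite ev_in.
  - rewrite !(joinR _ _ _ hi) !(joinR _ _ _ hj) => /ev_inj h.
    by apply: val_inj; rewrite /= hi hj h.
move=> i; suff: join e (@ev S) (@ev T) i \in U.
  by case/ev_surj => j <-; apply: codom_f.
have hx x : (x \in U) = (x \in S) || (x \in T) by rewrite -hU inE.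
rewrite hx; case: (split_ordP e i) => -[i' hi].
  by rewrite (joinL _ _ _ hi) ev_in.
by rewrite (joinR _ _ _ hi) ev_in orbT.
Qed.

End Enumeration.

Section Shuffles.
Variables (p q l : nat) (e : (p + q)%N = l).

Definition inL (i : 'I_p) : 'I_l := cast_ord e (lshift q i).
Definition inR (j : 'I_q) : 'I_l := cast_ord e (rshift p j).

Lemma joinEL (I : Type) (f : 'I_p -> I) (g : 'I_q -> I) i : join e f g (inL i) = f i.
Proof. exact: joinL. Qed.

Lemma joinER (I : Type) (f : 'I_p -> I) (g : 'I_q -> I) j : join e f g (inR j) = g j.
Proof. exact: joinR. Qed.

Lemma inLR (i : 'I_l) : (exists j, i = inL j) \/ (exists j, i = inR j).
Proof.
by case: (split_ordP e i) => -[j h]; [left | right]; exists j; apply: val_inj.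
Qed.

Lemma shufflesP (s : 'S_l) :
  reflect ((forall i j : 'I_p, (i < j)%N -> (s (inL i) < s (inL j))%N) /\
           (forall i j : 'I_q, (i < j)%N -> (s (inR i) < s (inR j))%N))
          (s \in shuffles e).
Proof.
rewrite inE; apply: (iffP forallP) => [hs|[hL hR] i].
  split=> i j ij.
    have /forallP/(_ (inL j))/implyP := hs (inL i); apply.
    by rewrite /= ij ltn_ord.
  have /forallP/(_ (inR j))/implyP := hs (inR i); apply.
  by rewrite /= ltn_add2l ij leq_addr orbT.
apply/forallP => j; apply/implyP => /andP[ij hij].
case: (inLR i) => -[i' ei]; case: (inLR j) => -[j' ej]; subst i j.
- exact: hL.
- by move: hij; rewrite /= ltnNge leq_addr /= leqNgt ltn_ord.
- by move: ij; rewrite /= ltnNge ltnW // (leq_trans (ltn_ord j')) ?leq_addr.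
- by apply: hR; rewrite /= ltn_add2l in ij.
Qed.

End Shuffles.

(** * Bijection between (p,q)-shuffles and p-element subsets *)

Section ShuffleSets.
Variables (N p q : nat) (U : {set 'I_N}) (e : (p + q)%N = #|U|).
Implicit Types (s : 'S_#|U|) (S : {set 'I_N}).

Lemma ltn_ev (i j : 'I_#|U|) : (ev i < ev j)%N = (i < j)%N.
Proof.
case: (ltngtP i j) => [/ev_mono //|/ev_mono h|/val_inj ->].
  by rewrite ltnNge ltnW.
by rewrite ltnn.
Qed.

Definition shuffle_set s : {set 'I_N} := [set ev (s (inL e i)) | i : 'I_p].

Lemma shuffle_set_sub s : shuffle_set s \subset U.
Proof. by apply/subsetP => x /imsetP [i _ ->]; apply: ev_in. Qed.

Lemma mem_shuffle_setD s x :
  reflect (exists j, ev (s (inR e j)) = x) (x \in U :\: shuffle_set s).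
Proof.
apply: (iffP setDP) => [[/ev_surj [i <-] hi]|[j <-]].
  rewrite -[i](permKV s) in hi *; case: (inLR e (s^-1%g i)) => -[j hj].
    by case/negP: hi; apply/imsetP; exists j; rewrite // hj.
  by exists j; rewrite hj.
split; first exact: ev_in.
apply/imsetP => -[i _ /ev_inj/perm_inj/(congr1 val) /= h].
by have := ltn_ord i; rewrite -h ltnNge leq_addr.
Qed.

(** A shuffle increases on each of its two blocks, so by [mono_enum] each block is the increasing
    enumeration of its image. *)
Lemma shuffle_set_enum s : s \in shuffles e ->
  exists (ep : p = #|shuffle_set s|) (eq : q = #|U :\: shuffle_set s|),
    forall i, ev (s i) = join e (@ev N (shuffle_set s) \o cast_ord ep)
                                (@ev N (U :\: shuffle_set s) \o cast_ord eq) i.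
Proof.
case/shufflesP => hL hR.
have [|x|ep hp] := @mono_enum N p (fun i => ev (s (inL e i))) (shuffle_set s).
- by move=> i j /hL; apply: ev_mono.
- by apply: (iffP imsetP) => [[i _ ->]|[i <-]]; exists i.
have [|x|eq hq] := @mono_enum N q (fun i => ev (s (inR e i))) (U :\: shuffle_set s).
- by move=> i j /hR; apply: ev_mono.
- exact: mem_shuffle_setD.
exists ep, eq => i; case: (inLR e i) => -[j ->].
  by rewrite joinEL hp.
by rewrite joinER hq.
Qed.

(** By [shuffle_set_enum] the image of the first block determines both enumerations, hence the
    shuffle. *)
Lemma shuffle_set_inj : {in shuffles e &, injective shuffle_set}.
Proof.
move=> s t /shuffle_set_enum [ep [eq hs]] /shuffle_set_enum [ep' [eq' ht]] h.
apply/permP => i; apply: ev_inj; rewrite hs ht.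
rewrite -h in ep' eq' ht *.
by rewrite (eq_irrelevance ep ep') (eq_irrelevance eq eq').
Qed.

End ShuffleSets.

Lemma shuffle_set_surj N p q (U : {set 'I_N}) (e : (p + q)%N = #|U|)
    (S : {set 'I_N}) : S \subset U -> #|S| = p ->
  exists2 s, s \in shuffles e & S = shuffle_set e s.
Proof.
move=> sSU ep; have eq : #|U :\: S| = q.
  by apply: (@addnI p); rewrite -{1}ep -{1}(setIidPr sSU) cardsID -e.
subst p q; have [e' [s hs]] := splits_exist (split_setD sSU).
rewrite (eq_irrelevance e' e) in hs.
exists s; last first.
  apply/setP => x; apply/idP/imsetP => [/ev_surj [i <-]|[i _ ->]].
    by exists i; rewrite // hs joinEL.
  by rewrite hs joinEL ev_in.
apply/shufflesP; split => i j ij; rewrite -ltn_ev !hs ?joinEL ?joinER.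
  exact: ev_mono.
exact: ev_mono.
Qed.

(** * Multiplication of A indexed by disjoint subsets *)

Section SetMultiplication.
Variables (k : comPzRingType) (A : monoid_data k) (N : nat).
Implicit Types R S T U V W : {set 'I_N}.

(* Meaningful when U is the disjoint union of S and T; the permutation is then
   the shuffle listing U in the order of S followed by T. *)
Definition set_mul S T U (a : A #|S|) (b : A #|T|) : A #|U| :=
  match (#|S| + #|T|)%N =P #|U| with
  | ReflectT e =>
      mu A _ (gen e (odflt 1%g [pick s : 'S_#|U| |
        [forall i, ev (s i) == join e (@ev N S) (@ev N T) i]]) a b)
  | ReflectF _ => 0
  end.

(** Injectivity of [ev] makes the merging permutation unique, so the choice by [pick] and its
    default value disappear. *)
Lemma set_mulE S T U (e : (#|S| + #|T|)%N = #|U|) s a b :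
  splits e s -> set_mul U a b = mu A _ (gen e s a b).
Proof.
move=> hs; rewrite /set_mul; case: eqP => // e'.
rewrite (eq_irrelevance e' e); case: pickP => [s' /forallP hs'|/(_ s)].
  congr (mu A _ (gen e _ a b)); apply/permP=> i; apply: ev_inj.
  by rewrite hs; apply/eqP.
by move/negP; case; apply/forallP => i; apply/eqP.
Qed.

Lemma set_mulDl S T U (a a' : A #|S|) (b : A #|T|) :
  set_mul U (a + a') b = set_mul U a b + set_mul U a' b.
Proof.
rewrite /set_mul; case: eqP => [e|_]; last by rewrite addr0.
by rewrite (balDl (gen_balanced A A _)) linearD.
Qed.

Lemma set_mulDr S T U (a : A #|S|) (b b' : A #|T|) :
  set_mul U a (b + b') = set_mul U a b + set_mul U a b'.
Proof.
rewrite /set_mul; case: eqP => [e|_]; last by rewrite addr0.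
by rewrite (balDr (gen_balanced A A _)) linearD.
Qed.

Lemma set_mulZl S T U c (a : A #|S|) (b : A #|T|) :
  set_mul U (c *: a) b = c *: set_mul U a b.
Proof.
rewrite /set_mul; case: eqP => [e|_]; last by rewrite scaler0.
by rewrite (balZl (gen_balanced A A _)) linearZ_LR.
Qed.

Lemma set_mulZr S T U c (a : A #|S|) (b : A #|T|) :
  set_mul U a (c *: b) = c *: set_mul U a b.
Proof.
rewrite /set_mul; case: eqP => [e|_]; last by rewrite scaler0.
by rewrite (balZr (gen_balanced A A _)) linearZ_LR.
Qed.

Lemma set_mul0l S T U (b : A #|T|) : set_mul U (0 : A #|S|) b = 0.
Proof. by rewrite -(scale0r 0) set_mulZl scale0r. Qed.

Lemma set_mul0r S T U (a : A #|S|) : set_mul U a (0 : A #|T|) = 0.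
Proof. by rewrite -(scale0r 0) set_mulZr scale0r. Qed.

Lemma set_mul_suml (J : Type) (r : seq J) (P : pred J) S T U
    (F : J -> A #|S|) (b : A #|T|) :
  set_mul U (\sum_(i <- r | P i) F i) b = \sum_(i <- r | P i) set_mul U (F i) b.
Proof.
apply: (big_morph (fun a => set_mul U a b)) => [a a'|]; first exact: set_mulDl.
exact: set_mul0l.
Qed.

Lemma set_mul_sumr (J : Type) (r : seq J) (P : pred J) S T U
    (a : A #|S|) (F : J -> A #|T|) :
  set_mul U a (\sum_(i <- r | P i) F i) = \sum_(i <- r | P i) set_mul U a (F i).
Proof.
apply: (big_morph (fun b => set_mul U a b)) => [b b'|]; first exact: set_mulDr.
exact: set_mul0r.
Qed.

Hypothesis hA : commutative_shuffle_algebra A.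

Lemma set_mulC S T U (a : A #|S|) (b : A #|T|) :
  split_set S T U -> set_mul U a b = set_mul U b a.
Proof.
move=> h; have [e [s hs]] := splits_exist h.
have e' : (#|T| + #|S|)%N = #|U| by rewrite addnC.
rewrite (set_mulE _ _ hs) (mu_C hA _ e').
rewrite (set_mulE (e := e') (s := s \oP chi e')) // => i.
by rewrite permM hs join_chi.
Qed.

(** Both composite permutations list [U] in the order [S], [T], [R], hence agree after [ev] and so
    are equal. *)
Lemma set_mulA S T R V W U (a : A #|S|) (b : A #|T|) (c : A #|R|) :
  split_set S T V -> split_set V R U -> split_set T R W -> split_set S W U ->
  set_mul U (set_mul V a b) c = set_mul U a (set_mul W b c).
Proof.
move=> /splits_exist [e1 [t ht]] /splits_exist [e2 [s hs]].
move=> /splits_exist [e4 [t' ht']] /splits_exist [e3 [s' hs']].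
rewrite (set_mulE _ _ ht) (set_mulE _ _ hs) (set_mulE _ _ ht') (set_mulE _ _ hs').
apply: (mu_A hA); apply/permP=> i; apply: ev_inj.
rewrite !permM hs hs' !join_block_sum.
rewrite (eq_join e2 (f' := join e1 (@ev N S) (@ev N T)) (g' := @ev N R)); first last.
- by move=> j /=; rewrite perm1.
- by move=> j /=; rewrite ht.
rewrite (eq_join e3 (f' := @ev N S) (g' := join e4 (@ev N T) (@ev N R))); first last.
- by move=> j /=; rewrite ht'.
- by move=> j /=; rewrite perm1.
exact: joinA.
Qed.

Definition set_one : A #|@set0 'I_N| :=
  transport (esym (cards0 _)) (eta A 0%N (1 : k)).

Lemma set_mul1 U (b : A #|U|) : set_mul U set_one b = b.
Proof.
have e : (#|@set0 'I_N| + #|U|)%N = #|U| by rewrite cards0.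
rewrite (set_mulE (e := e) (s := 1%g)) => [|i].
  rewrite /set_one; move: (esym _) e; case: _ / => e.
  by rewrite transport_id (mu_1l hA _ erefl) scale1r sact1 transport_id.
rewrite perm1; case: (split_ordP e i) => -[j hi].
  by move: (ev_in j); rewrite inE.
rewrite (joinR _ _ _ hi); congr ev; apply: val_inj.
by rewrite /= hi cards0.
Qed.

End SetMultiplication.

(** * The ring B_N *)

Section SetFunctionRing.
Variables (k : comPzRingType) (A : monoid_data k).
Hypothesis hA : commutative_shuffle_algebra A.
(* Excludes the zero algebra, for which {poly _} is not available. *)
Hypothesis nz : eta A 0%N (1 : k) <> 0.

Definition setfun (N : nat) : Type := forall S : {set 'I_N}, A #|S|.

HB.instance Definition _ N := gen_eqMixin (setfun N).
HB.instance Definition _ N := gen_choiceMixin (setfun N).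

Section Ring.
Variable N : nat.
Implicit Types (f g h : setfun N) (S T U V : {set 'I_N}).

Lemma setfunP f g : (forall S, f S = g S) -> f = g.
Proof. exact: functional_extensionality_dep. Qed.

Definition setfun_add f g : setfun N := fun S => f S + g S.
Definition setfun_opp f : setfun N := fun S => - f S.
Definition setfun_zero : setfun N := fun S => 0.

Lemma setfun_addA : associative setfun_add.
Proof. by move=> f g h; apply: setfunP => S; apply: addrA. Qed.

Lemma setfun_addC : commutative setfun_add.
Proof. by move=> f g; apply: setfunP => S; apply: addrC. Qed.

Lemma setfun_add0 : left_id setfun_zero setfun_add.
Proof. by move=> f; apply: setfunP => S; apply: add0r. Qed.

Lemma setfun_addN : left_inverse setfun_zero setfun_opp setfun_add.
Proof. by move=> f; apply: setfunP => S; apply: addNr. Qed.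

HB.instance Definition _ := GRing.isZmodule.Build (setfun N)
  setfun_addA setfun_addC setfun_add0 setfun_addN.

Lemma setfunD f g S : (f + g) S = f S + g S. Proof. by []. Qed.

Definition setfun_mul f g : setfun N :=
  fun U => \sum_(S : {set 'I_N} | S \subset U) set_mul U (f S) (g (U :\: S)).

Definition setfun_one : setfun N :=
  fun U => match set0 =P U with
           | ReflectT e => transport (congr1 (fun V => #|V|) e) (set_one A N)
           | ReflectF _ => 0
           end.

Lemma setfun_one0 : setfun_one set0 = set_one A N.
Proof.
by rewrite /setfun_one; case: eqP => // e; rewrite transport_id.
Qed.

Lemma setfun_oneN U : U != set0 -> setfun_one U = 0.
Proof. by rewrite /setfun_one eq_sym; case: eqP. Qed.

Lemma setfun_mulC : commutative setfun_mul.
Proof.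
move=> f g; apply: setfunP => U; rewrite /setfun_mul.
rewrite (reindex_onto (fun S => U :\: S) (fun S => U :\: S)) /=; last first.
  by move=> S sSU; rewrite setDDr setDv set0U; apply/setIidPr.
apply: eq_big => [S|S /andP[_ /eqP hS]].
  rewrite subsetDl setDDr setDv set0U /=.
  by apply/eqP/idP => [<-|/setIidPr//]; rewrite subsetIl.
have sSU : S \subset U by rewrite -hS subsetDl.
by rewrite (set_mulC hA) ?hS // split_setC split_setD.
Qed.

(** Both sides sum over the decompositions of [U] into three disjoint parts: one chooses the first
    part [S] and then the second part [T], the other their union [V] and then [S]. *)
Lemma setfun_mulA : associative setfun_mul.
Proof.
move=> f g h; apply: setfunP => U; rewrite /setfun_mul.
pose G S T R := set_mul U (f S) (set_mul (U :\: S) (g T) (h R)).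
transitivity (\sum_(S : {set 'I_N} | S \subset U)
  \sum_(T : {set 'I_N} | T \subset U :\: S) G S T (U :\: S :\: T)).
  by apply: eq_bigr => S _; rewrite set_mul_sumr.
transitivity (\sum_(V : {set 'I_N} | V \subset U)
  \sum_(S : {set 'I_N} | S \subset V) G S (V :\: S) (U :\: V)); last first.
  apply: eq_bigr => V sVU; rewrite set_mul_suml; apply: eq_bigr => S sSV.
  have sSU := subset_trans sSV sVU.
  rewrite (set_mulA hA (W := U :\: S)) ?split_setD //.
  rewrite /split_set -setI_eq0; apply/andP; split; apply/eqP/setP => x;
    have /implyP := subsetP sSV x; have /implyP := subsetP sVU x;
    by rewrite !inE; do 3!case: (_ \in _).
rewrite [RHS](exchange_big_dep (fun S => S \subset U)) /=; last first.
  by move=> V S sVU sSV; exact: (subset_trans sSV sVU).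
apply: eq_bigr => S sSU; apply: esym.
(* For fixed [S], the sets [V] between [S] and [U] correspond to their differences [T] with [S]. *)
rewrite (reindex_onto (fun T => S :|: T) (fun V => V :\: S)) /=; last first.
  by move=> V /andP[_ sSV]; rewrite -{1}(setIidPr sSV) setID.
apply: eq_big => [T|T].
  rewrite subUset sSU subsetUl andbT /= setDUl setDv set0U.
  rewrite subsetD; case sTU: (T \subset U) => //=.
  by apply/eqP/setDidPl.
case/andP=> _ /eqP ->; congr G.
by rewrite setDDl.
Qed.

Lemma setfun_mul1 : left_id setfun_one setfun_mul.
Proof.
move=> f; apply: setfunP => U; rewrite /setfun_mul.
rewrite (bigD1 set0) ?sub0set //= big1 ?addr0.
  by rewrite setfun_one0 setD0 (set_mul1 hA).
by move=> S /andP[_ S0]; rewrite setfun_oneN // set_mul0l.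
Qed.

Lemma setfun_mulDl : left_distributive setfun_mul +%R.
Proof.
move=> f g h; apply: setfunP => U; rewrite setfunD /setfun_mul -big_split /=.
by apply: eq_bigr => S _; rewrite set_mulDl.
Qed.

Lemma setfun_one_neq0 : setfun_one != 0.
Proof.
apply/eqP => /(congr1 (fun f : setfun N => f set0)).
by rewrite setfun_one0 => /transport_eq0.
Qed.

HB.instance Definition _ := GRing.Zmodule_isComNzRing.Build (setfun N)
  setfun_mulA setfun_mulC setfun_mul1 setfun_mulDl setfun_one_neq0.

Lemma setfunM f g U :
  (f * g) U
  = \sum_(S : {set 'I_N} | S \subset U) set_mul U (f S) (g (U :\: S)).
Proof. by []. Qed.

Lemma setfun1_set0 : (1 : setfun N) set0 = set_one A N.
Proof. exact: setfun_one0. Qed.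

Lemma setfun1N U : U != set0 -> (1 : setfun N) U = 0.
Proof. exact: setfun_oneN. Qed.

Lemma setfun_sum (J : Type) (r : seq J) (P : pred J) (F : J -> setfun N) S :
  (\sum_(i <- r | P i) F i) S = \sum_(i <- r | P i) F i S.
Proof. exact: (big_morph (fun f : setfun N => f S)). Qed.

End Ring.

(** * Divided powers in B_N *)

Section DividedPowers.
Variable N : nat.
Implicit Types (f g w : setfun N) (S T U : {set 'I_N}).

Definition component f S : setfun N := fun U => if U == S then f U else 0.

Lemma component_sum f : f = \sum_S component f S.
Proof.
apply: setfunP => U; rewrite setfun_sum (bigD1 U) //= /component eqxx.
by rewrite big1 ?addr0 // => S; rewrite eq_sym => /negbTE ->.
Qed.

Lemma componentD f g S : component (f + g) S = component f S + component g S.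
Proof.
apply: setfunP => U; rewrite setfunD /component setfunD.
by case: eqP; rewrite ?addr0.
Qed.

Lemma component_set0 f S : f set0 = 0 -> component f S set0 = 0.
Proof. by rewrite /component; case: eqP. Qed.

Lemma setfunM_set0 f g : g set0 = 0 -> (f * g) set0 = 0.
Proof.
move=> g0; rewrite setfunM big1 // => S; rewrite subset0 => /eqP ->.
by rewrite setD0 g0 set_mul0r.
Qed.

(** A nonzero term would split its set into two disjoint parts both equal to [S]; then [S] is empty,
    where [f] vanishes. *)
Lemma component_mul f g S : f set0 = 0 -> component f S * component g S = 0.
Proof.
move=> f0; apply: setfunP => U; rewrite setfunM big1 // => T sTU.
rewrite /component; case: eqP => [eTS|_]; last by rewrite set_mul0l.
case: eqP => [eUS|_]; last by rewrite set_mul0r.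
have T0 : T = set0.
  by apply/setP=> x; move/setP/(_ x): eUS; rewrite -eTS !inE; case: (x \in T).
by rewrite T0 f0 set_mul0l.
Qed.

Definition concentrated w := exists S, forall U, U != S -> w U = 0.

Lemma component_concentrated f S : concentrated (component f S).
Proof. by exists S => U; rewrite /component => /negbTE ->. Qed.

Lemma concentratedM f g :
  concentrated f -> concentrated g -> concentrated (f * g).
Proof.
move=> [S hS] [T hT]; exists (S :|: T) => U hU; rewrite setfunM big1 // => V sVU.
have [eV|/hS->] := eqVneq V S; last by rewrite set_mul0l.
have [eW|/hT->] := eqVneq (U :\: V) T; last by rewrite set_mul0r.
case/eqP: hU; rewrite -eW -eV; apply/setP => x; have /implyP := subsetP sVU x.
by rewrite !inE; do 2!case: (_ \in _).
Qed.

Definition dpoly f : {poly setfun N} := esym_poly (index_enum _) (component f).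

Definition dpow n f : setfun N := (dpoly f)`_n.

Lemma dpoly_add f g : f set0 = 0 -> dpoly (f + g) = dpoly f * dpoly g.
Proof.
move=> f0; rewrite /dpoly -esym_poly_add => [|S]; last exact: component_mul.
by rewrite /esym_poly; apply: eq_bigr => S _; rewrite componentD.
Qed.

Lemma dpoly_concentrated w : concentrated w -> dpoly w = 1 + w%:P * 'X.
Proof.
case=> S hS; rewrite /dpoly /esym_poly (bigD1 S) //= big1 => [|T TS].
  rewrite mulr1; congr (1 + _%:P * 'X); apply: setfunP => U.
  by rewrite /component; case: eqP => // /eqP/hS.
have -> : component w T = 0.
  apply: setfunP => U; rewrite /component; case: eqP => // ->.
  by rewrite hS.
by rewrite mul0r addr0.
Qed.

Lemma dpoly0 : dpoly 0 = 1.
Proof.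
rewrite dpoly_concentrated ?mul0r ?addr0 //.
by exists set0.
Qed.

(** Divided powers can be computed from any decomposition into concentrated summands, not only from
    the components; this serves products and restrictions. *)
Lemma dpoly_sum (J : Type) (r : seq J) (w : J -> setfun N) :
  (forall i, w i set0 = 0) -> (forall i, concentrated (w i)) ->
  dpoly (\sum_(i <- r) w i) = esym_poly r w.
Proof.
move=> w0 wc; elim: r => [|i r IH]; first by rewrite /esym_poly !big_nil dpoly0.
by rewrite big_cons dpoly_add // IH dpoly_concentrated // esym_poly_cons.
Qed.

Lemma dpow0 f : dpow 0 f = 1.
Proof. exact: esym_poly0. Qed.

Lemma dpow1 f : dpow 1 f = f.
Proof. by rewrite /dpow /dpoly esym_poly1 -component_sum. Qed.

Lemma dpowM n m f : f set0 = 0 ->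
  dpow n f * dpow m f = dpow (n + m) f *+ 'C(n + m, n).
Proof. by move=> f0; apply: esym_polyM => S; apply: component_mul. Qed.

Lemma dpowD n f g : f set0 = 0 ->
  dpow n (f + g) = \sum_(i < n.+1) dpow i f * dpow (n - i) g.
Proof. by move=> f0; rewrite /dpow dpoly_add // coefM. Qed.

(** Each [f * component g S] behaves like one variable, with polynomial 1 + (f g_S) X, so the family
    g_S is merely scaled by [f]. *)
Lemma dpow_mul n f g : g set0 = 0 -> dpow n (f * g) = f ^+ n * dpow n g.
Proof.
move=> g0; have gc0 S : component g S set0 = 0 by apply: component_set0.
rewrite /dpow {1}[g]component_sum mulr_sumr.
suff -> : dpoly (\sum_S f * component g S)
    = esym_poly (index_enum _) (fun S => f * component g S).
  by rewrite esym_poly_scale.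
rewrite /esym_poly.
elim: (index_enum _) => [|S r IH]; first by rewrite !big_nil dpoly0.
rewrite !big_cons dpoly_add; last exact: setfunM_set0.
congr (_ * _); last exact: IH.
(* The summands f_T g_S are concentrated, and any two of them multiply to zero because g_S squares
   to zero. *)
rewrite [f]component_sum mulr_suml dpoly_sum.
- rewrite esym_poly_ortho // => T T'; rewrite mulrACA component_mul ?mulr0 //.
- by move=> T; apply: setfunM_set0.
- by move=> T; apply: concentratedM; apply: component_concentrated.
Qed.

Lemma esym_poly_set0 (J : Type) (r : seq J) (w : J -> setfun N) n :
  (forall i, w i set0 = 0) -> (esym_poly r w)`_n.+1 set0 = 0.
Proof.
move=> w0; elim: r n => [|i r IH] n; first by rewrite esym_poly_nil coef1.
by rewrite esym_poly_cons coef_linear_mul setfunD IH mulrC setfunM_set0 // addr0.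
Qed.

Lemma dpow_concentrated n w : concentrated w -> dpow n.+2 w = 0.
Proof.
by move=> wc; rewrite /dpow dpoly_concentrated // coefD coef1 coefCM coefX mulr0 addr0.
Qed.

(* Induction on the number of components of f: for a single component x,
   gamma_m(x + f) = gamma_m f + x gamma_(m-1) f, whose second term y has
   E(y) = 1 + y X. *)
Lemma dpow_comp n m f : f set0 = 0 ->
  dpow n (dpow m.+1 f) = dpow (n * m.+1) f *+ block_partitions n m.+1.
Proof.
move=> f0; rewrite /dpow (_ : dpoly f = esym_poly (index_enum _) (component f)) //.
have c0 S : component f S set0 = 0 by apply: component_set0.
elim: (index_enum _) n m => [|S r IH] n m.
  rewrite !esym_poly_nil !coef1 /= dpoly0 coef1.
  by case: n => [|n]; rewrite ?block_partitions0 // mul0rn.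
rewrite esym_poly_cons coef_linear_mul.
set x := component f S; set p := esym_poly r _.
have x0 : x set0 = 0 by apply: c0.
rewrite dpoly_add; last exact: esym_poly_set0.
have -> : dpoly (x * p`_m) = 1 + (x * p`_m)%:P * 'X.
  apply/polyP => -[|[|j]].
  - by rewrite [LHS]dpow0 coefD coef1 coefCM coefX mulr0 addr0.
  - by rewrite [LHS]dpow1 coefD coef1 coefCM coefX mulr1 add0r.
  (* By [dpow_mul] this coefficient is a multiple of gamma_(j+2) of [x], which vanishes because [x]
     is concentrated. *)
  - transitivity (dpow j.+2 (p`_m * x)); first by rewrite mulrC.
    rewrite dpow_mul // dpow_concentrated; last exact: component_concentrated.
    by rewrite mulr0 coefD coef1 coefCM coefX mulr0 addr0.
rewrite mulrC coef_linear_mul; case: n => [|n].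
  rewrite mulr0 addr0 mul0n block_partitions0 [LHS]dpow0.
  by rewrite coef_linear_mul mulr0 addr0 esym_poly0.
rewrite !IH mulSn addSn coef_linear_mul -addSn mulrnDl; congr (_ + _).
(* In the term with [x], [esym_polyM] contributes the binomial coefficient that turns
   [block_partitions n m.+1] into [block_partitions n.+1 m.+1]. *)
rewrite -mulrA mulrnAr [p`_m * _]mulrC esym_polyM; last first.
  by move=> T; apply: component_mul.
by rewrite block_partitionsS -mulrnA mulrnAr (addnC m) (mulnC (block_partitions _ _)).
Qed.

End DividedPowers.

(** * Constant functions and restriction *)

Section Homogeneous.
Variable N : nat.
Implicit Types (f g w : setfun N) (S T U : {set 'I_N}).

Definition homogeneous d f := forall S, #|S| != d -> f S = 0.

Lemma homogeneousM d d' f g :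
  homogeneous d f -> homogeneous d' g -> homogeneous (d + d')%N (f * g).
Proof.
move=> hf hg U hU; rewrite setfunM big1 // => S sSU.
have [eS|/hf->] := eqVneq #|S| d; last by rewrite set_mul0l.
have [eT|/hg->] := eqVneq #|U :\: S| d'; last by rewrite set_mul0r.
by case/eqP: hU; rewrite -eS -eT -(cardsID S U) (setIidPr sSU).
Qed.

Lemma dpow_homogeneous d n f : homogeneous d f -> homogeneous (n * d)%N (dpow n f).
Proof.
move=> hf; rewrite /dpow /dpoly.
elim: (index_enum _) n => [|S r IH] n.
  rewrite esym_poly_nil coef1; case: n => [|n] U hU //=.
  by rewrite [LHS]setfun1N // -cards_eq0.
rewrite esym_poly_cons coef_linear_mul => U hU; rewrite setfunD IH // add0r.
case: n hU => [|n] hU; first by rewrite mulr0.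
suff : homogeneous (n.+1 * d)%N (component f S * (esym_poly r (component f))`_n).
  by apply.
rewrite mulSn; apply: homogeneousM => // V hV.
by rewrite /component hf // if_same.
Qed.

Definition const_setfun p (a : A p) : setfun N := fun S =>
  match p =P #|S| with
  | ReflectT e => transport e a
  | ReflectF _ => 0
  end.

Lemma const_setfunE p (a : A p) S (e : p = #|S|) : const_setfun a S = transport e a.
Proof.
by rewrite /const_setfun; case: eqP => // e'; rewrite (eq_irrelevance e' e).
Qed.

Lemma const_setfunN p (a : A p) S : p <> #|S| -> const_setfun a S = 0.
Proof. by rewrite /const_setfun; case: eqP. Qed.

Lemma const_homogeneous p (a : A p) : homogeneous p (const_setfun a).
Proof. by move=> S hS; apply: const_setfunN => h; rewrite -h eqxx in hS. Qed.

Lemma const_set0 p (a : A p) : (0 < p)%N -> const_setfun a set0 = 0.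
Proof. by move=> p0; apply: const_homogeneous; rewrite cards0 eq_sym -lt0n. Qed.

Lemma constD p (a b : A p) :
  const_setfun (a + b) = const_setfun a + const_setfun b.
Proof.
apply: setfunP => S; rewrite setfunD /const_setfun.
by case: eqP => [e|_]; rewrite ?addr0 // transportD.
Qed.

Lemma const0 p : const_setfun (0 : A p) = 0.
Proof.
by apply: setfunP => S; rewrite /const_setfun; case: eqP => // e; rewrite transport0.
Qed.

Lemma const1 : const_setfun (eta A 0%N (1 : k)) = 1.
Proof.
apply: setfunP => S; have [->|S0] := eqVneq S set0.
  by rewrite setfun1_set0 (const_setfunE _ (esym (cards0 _))).
rewrite setfun1N // const_setfunN // => h.
by move: S0; rewrite -cards_eq0 -h.
Qed.

Lemma set_mul_transport p q l S T U (ep : p = #|S|) (eq : q = #|T|)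
    (el : l = #|U|) (e : (p + q)%N = l) (s : 'S_l) (a : A p) (b : A q) :
  (forall i, ev (cast_ord el (s i))
     = join e (@ev N S \o cast_ord ep) (@ev N T \o cast_ord eq) i) ->
  set_mul U (transport ep a) (transport eq b) = transport el (mu A l (gen e s a b)).
Proof.
subst p q l => hs; rewrite !transport_id; apply: set_mulE => i.
rewrite -[s i](cast_ord_id erefl) hs; apply: eq_join => j /=; by rewrite cast_ord_id.
Qed.

End Homogeneous.

Section Restriction.
Variables (M N : nat) (h : 'I_M -> 'I_N).
Hypothesis h_mono : forall i j : 'I_M, (i < j)%N -> (h i < h j)%N.
Implicit Types (f g w : setfun N) (S T U : {set 'I_M}).

Lemma mono_inj : injective h.
Proof.
move=> i j hij; apply: val_inj => /=; case: (ltngtP i j) => // /h_mono.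
  by rewrite hij ltnn.
by rewrite hij ltnn.
Qed.

Lemma card_mono S : #|h @: S| = #|S|.
Proof. exact: card_imset mono_inj. Qed.

Definition restr f : setfun M := fun S => transport (card_mono S) (f (h @: S)).

Lemma ev_imset S (i : 'I_#|h @: S|) : h (ev (cast_ord (card_mono S) i)) = ev i.
Proof.
have [] := @mono_enum N #|S| (h \o @ev M S) (h @: S).
- by move=> a b ab; apply/h_mono/ev_mono.
- move=> x; apply: (iffP imsetP) => [[y /ev_surj [j <-] ->]|[j <-]].
    by exists j.
  by exists (ev j); rewrite ?ev_in.
move=> e /(_ (cast_ord (card_mono S) i)) /= ->; congr ev; exact: val_inj.
Qed.

Lemma split_set_imset S T U :
  split_set S T U -> split_set (h @: S) (h @: T) (h @: U).
Proof.
case/andP=> d /eqP <-; rewrite /split_set imsetU eqxx andbT.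
move: d; rewrite -!setI_eq0 -imsetI => [/eqP->|x y _ _]; first by rewrite imset0.
exact: mono_inj.
Qed.

(** As [h] preserves order, the permutation that merges the images of [S] and [T] also merges [S]
    and [T]. *)
Lemma set_mul_imset S T U (a : A #|h @: S|) (b : A #|h @: T|) :
  split_set S T U ->
  transport (card_mono U) (set_mul (h @: U) a b)
  = set_mul U (transport (card_mono S) a) (transport (card_mono T) b).
Proof.
move=> /split_set_imset/splits_exist [e [s hs]]; rewrite (set_mulE _ _ hs).
apply/esym/set_mul_transport => i; apply: mono_inj; rewrite ev_imset hs.
case: (split_ordP e i) => -[j hi].
  by rewrite !(joinL _ _ _ hi) /= ev_imset.
by rewrite !(joinR _ _ _ hi) /= ev_imset.
Qed.

Lemma restrD f g : restr (f + g) = restr f + restr g.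
Proof. by apply: setfunP => S; rewrite /restr [LHS]transportD. Qed.

Lemma restr0 : restr 0 = 0.
Proof. by apply: setfunP => S; rewrite /restr [LHS]transport0. Qed.

Lemma transport_setfun f (V V' : {set 'I_N}) j (e : #|V| = j) (e' : #|V'| = j) :
  V = V' -> transport e (f V) = transport e' (f V').
Proof. by move=> h'; case: V' / h' e' => e'; rewrite (eq_irrelevance e e'). Qed.

(** The subsets of the image of [U] are exactly the images of the subsets of [U], so the two sums
    match term by term. *)
Lemma restrM f g : restr (f * g) = restr f * restr g.
Proof.
apply: setfunP => U; rewrite /restr !setfunM transport_sum.
rewrite (reindex_onto (fun S => h @: S) (fun V => h @^-1: V)) /=; last first.
  move=> V sVU; apply/setP => x; apply/imsetP/idP => [[y]|xV].
    by rewrite inE => yV ->.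
  have /imsetP [y _ exy] := subsetP sVU x xV.
  by exists y; rewrite // inE -exy.
apply: eq_big => [S|S].
  have -> : h @^-1: (h @: S) = S.
    by apply/setP => x; rewrite inE mem_imset //; apply: mono_inj.
  rewrite eqxx andbT; apply/idP/idP => [sSU|]; last exact: imsetS.
  apply/subsetP => x xS.
  by rewrite -(mem_imset _ _ mono_inj); apply: (subsetP sSU); apply: imset_f.
case/andP=> sSU /eqP hS.
have sSU' : S \subset U.
  apply/subsetP => x xS.
  by rewrite -(mem_imset _ _ mono_inj); apply: (subsetP sSU); apply: imset_f.
have hD : h @: U :\: h @: S = h @: (U :\: S).
  apply/setP => x; rewrite inE; apply/andP/imsetP.
    case=> xS /imsetP [y yU exy]; exists y => //; rewrite inE yU andbT.
    by apply: contra xS => yS; rewrite exy imset_f.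
  case=> y; rewrite inE => /andP [yS yU] ->.
  by rewrite !(mem_imset _ _ mono_inj).
rewrite hD set_mul_imset ?split_setD //.
Qed.

Lemma restr1 : restr 1 = 1.
Proof.
apply: setfunP => S; rewrite /restr; have [->|S0] := eqVneq S set0.
  rewrite (transport_setfun _ _ (etrans (cards0 _) (esym (cards0 _))) (imset0 h)).
  by rewrite !setfun1_set0 /set_one transport_comp; apply: transport_irr.
rewrite [RHS]setfun1N // setfun1N ?transport0 //.
by rewrite -cards_eq0 card_mono cards_eq0.
Qed.

Lemma restr_esym (J : Type) (r : seq J) (w : J -> setfun N) n :
  restr (esym_poly r w)`_n = (esym_poly r (restr \o w))`_n.
Proof.
elim: r n => [|i r IH] n.
  by rewrite !esym_poly_nil !coef1; case: n => [|n]; rewrite ?restr1 ?restr0.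
rewrite !esym_poly_cons !coef_linear_mul restrD restrM IH.
by case: n => [|n]; rewrite ?IH ?restr0.
Qed.

Lemma restr_set0 f : f set0 = 0 -> restr f set0 = 0.
Proof.
move=> f0; rewrite /restr.
rewrite (transport_setfun _ _ (etrans (cards0 _) (esym (cards0 _))) (imset0 h)).
by rewrite f0 transport0.
Qed.

Lemma restr_sum (J : Type) (r : seq J) (w : J -> setfun N) :
  restr (\sum_(i <- r) w i) = \sum_(i <- r) restr (w i).
Proof. exact: (big_morph restr restrD restr0). Qed.

(** The restricted components of [f] are again concentrated, on the preimages of their supports, so
    [dpoly_sum] computes the polynomial of [restr f] from them. *)
Lemma restr_dpow n f : f set0 = 0 -> restr (dpow n f) = dpow n (restr f).
Proof.
move=> f0; rewrite [in RHS](component_sum f) restr_sum /dpow dpoly_sum.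
- exact: restr_esym.
- by move=> S; apply: restr_set0; apply: component_set0.
- move=> S; exists (h @^-1: S) => U hU; rewrite /restr /component.
  case: eqP => [hS|_]; last by rewrite transport0.
  case/eqP: hU; rewrite -hS; apply/setP => x.
  by rewrite inE mem_imset //; apply: mono_inj.
Qed.

Lemma restr_const p (a : A p) : restr (const_setfun a) = const_setfun a.
Proof.
apply: setfunP => S; rewrite /restr.
have [e|/eqP ne] := eqVneq p #|S|.
  rewrite (const_setfunE _ e) (const_setfunE _ (etrans e (esym (card_mono S)))).
  by rewrite transport_comp; apply: transport_irr.
by rewrite (const_setfunN _ ne) const_setfunN ?transport0 // card_mono.
Qed.

End Restriction.

(** * The shuffle product as a product of constant functions *)

Section ShuffleProduct.
Variable N : nat.

Lemma const_mul p q l (e : (p + q)%N = l) (a : A p) (b : A q) :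
  const_setfun (shuffle_product e a b)
  = const_setfun a * const_setfun b :> setfun N.
Proof.
apply: setfunP => U; have [el|ne] := eqVneq l #|U|; last first.
  rewrite const_homogeneous 1?eq_sym //.
  have := homogeneousM (const_homogeneous (N := N) a) (const_homogeneous b).
  by rewrite e => -> //; rewrite eq_sym.
move: e; rewrite el => e; rewrite (const_setfunE _ (erefl #|U|)) transport_id setfunM.
rewrite (bigID (fun S : {set 'I_N} => #|S| == p)) /=.
rewrite [X in _ + X]big1 ?addr0; last first.
  by move=> S /andP[_ hS]; rewrite const_homogeneous ?set_mul0l.
(* The p-element subsets of [U] are replaced by the shuffles that they come from. *)
rewrite (eq_bigl (mem (@shuffle_set N p q U e @: shuffles e))); last first.
  move=> S; apply/andP/imsetP => [[sSU /eqP hS]|[s hs ->]].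
    exact: shuffle_set_surj.
  rewrite shuffle_set_sub; split=> //.
  by have [ep _] := shuffle_set_enum hs; rewrite -ep.
rewrite big_imset; last exact: shuffle_set_inj.
apply: eq_bigr => s /shuffle_set_enum [ep [eq hs]].
rewrite (const_setfunE _ ep) (const_setfunE _ eq).
rewrite (set_mul_transport (el := erefl) (e := e) (s := s)) ?transport_id //.
by move=> i; rewrite cast_ord_id.
Qed.

End ShuffleProduct.

Lemma card_setT l : #|[set: 'I_l]| = l.
Proof. by rewrite cardsT card_ord. Qed.

(** The value on the full set {0..l-1}; for l = np, [const_divided] shows that every l-element set
    gives the same value. *)
Definition divided n p l (a : A p) : A l :=
  transport (card_setT l) (dpow n (const_setfun a : setfun l) [set: 'I_l]).

(** Restriction along the increasing enumeration of an l-element set [U] carries the value at [U] to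
    the value at the full set, and fixes constant functions. *)
Lemma const_divided N n p l (a : A p) : (n * p)%N = l -> (0 < p)%N ->
  const_setfun (divided n l a) = dpow n (const_setfun a) :> setfun N.
Proof.
move=> e p0; apply: setfunP => U; have [el|ne] := eqVneq l #|U|; last first.
  rewrite const_homogeneous 1?eq_sym //.
  have := dpow_homogeneous (n := n) (const_homogeneous (N := N) a).
  by rewrite e => -> //; rewrite eq_sym.
have hm (i j : 'I_l) : (i < j)%N -> (ev (cast_ord el i) < ev (cast_ord el j))%N.
  by move=> ij; apply: ev_mono.
rewrite (const_setfunE _ el) /divided -(restr_const hm a) -restr_dpow ?const_set0 //.
rewrite /restr !transport_comp.
have hU : (fun i => ev (cast_ord el i)) @: [set: 'I_l] = U.
  apply/setP => x; apply/imsetP/idP => [[i _ ->]|/ev_surj [i <-]]; first exact: ev_in.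
  by exists (cast_ord (esym el) i); rewrite ?inE // cast_ordKV.
by rewrite (transport_setfun _ _ erefl hU) transport_id.
Qed.

Lemma const_inj p (a b : A p) :
  const_setfun a = const_setfun b :> setfun p -> a = b.
Proof.
move/(congr1 (fun f : setfun p => f [set: 'I_p])).
rewrite !(const_setfunE _ (esym (card_setT p))) => h.
by rewrite -[a](transportK (esym (card_setT p))) h transportK.
Qed.

(** * Embedding Psi(A) *)

Lemma Psi_odd m (x : Psi_level A m) : odd m -> x = 0.
Proof.
by rewrite /Psi_level in x * => om; rewrite om in x *; apply: zero_moduleP.
Qed.

Lemma Psi_outD m (x y : Psi_level A m) : Psi_out (x + y) = Psi_out x + Psi_out y.
Proof.
by move: x y; rewrite /Psi_out /Psi_level; case: (odd m) => x y //; rewrite addr0.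
Qed.

Lemma Psi_outZ m c (x : Psi_level A m) : Psi_out (c *: x) = c *: Psi_out x.
Proof.
by move: x; rewrite /Psi_out /Psi_level; case: (odd m) => x //; rewrite scaler0.
Qed.

Lemma Psi_out0 m : Psi_out (0 : Psi_level A m) = 0.
Proof. by rewrite -(scale0r 0) Psi_outZ scale0r. Qed.

Section PsiEmbedding.
Variable N : nat.

Definition Psi_emb m (x : Psi A m) : setfun N := const_setfun (Psi_out x).

Lemma Psi_embD m (x y : Psi A m) : Psi_emb (x + y) = Psi_emb x + Psi_emb y.
Proof. by rewrite /Psi_emb Psi_outD constD. Qed.

Lemma Psi_emb0 m : Psi_emb (0 : Psi A m) = 0.
Proof. by rewrite /Psi_emb Psi_out0 const0. Qed.

Lemma Psi_emb_sum (J : Type) (r : seq J) m (F : J -> Psi A m) :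
  Psi_emb (\sum_(i <- r) F i) = \sum_(i <- r) Psi_emb (F i).
Proof. exact: (big_morph _ (@Psi_embD m) (Psi_emb0 m)). Qed.

Lemma Psi_embMn m (x : Psi A m) n : Psi_emb (x *+ n) = Psi_emb x *+ n.
Proof.
by elim: n => [|n IH]; rewrite ?mulr0n ?Psi_emb0 // !mulrS Psi_embD IH.
Qed.

Lemma Psi_emb_odd m (x : Psi A m) : odd m -> Psi_emb x = 0.
Proof. by move=> om; rewrite (Psi_odd x om) Psi_emb0. Qed.

Lemma Psi_emb_in m (a : A m./2) :
  ~~ odd m -> Psi_emb (Psi_in a : Psi A m) = const_setfun a.
Proof. by move=> om; rewrite /Psi_emb Psi_inK. Qed.

Lemma Psi_emb1 : Psi_emb (gone (Psi A)) = 1.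
Proof. exact: const1. Qed.

Lemma Psi_embM m n l (e : (m + n)%N = l) (x : Psi A m) (y : Psi A n) :
  Psi_emb (gmul e x y) = Psi_emb x * Psi_emb y.
Proof.
have [ol|el] := boolP (odd l).
  rewrite (Psi_emb_odd _ ol); move: ol; rewrite -e oddD.
  have [om _|om] := boolP (odd m); first by rewrite (Psi_emb_odd _ om) mul0r.
  by rewrite /= => on; rewrite (Psi_emb_odd _ on) mulr0.
rewrite /gmul /= /Psi_mul; case: eqP => [e'|ne].
  by rewrite Psi_emb_in // const_mul.
(* Here l is even but the halves do not add up, so m and n are both odd and the factors vanish. *)
rewrite Psi_emb0; have [om|em] := boolP (odd m); first by rewrite Psi_emb_odd ?mul0r.
case: ne; rewrite -e halfD (negbTE em) /=.
by rewrite add0n.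
Qed.

Lemma Psi_emb_pow d (x : Psi A d) n : Psi_emb (gpow x n) = Psi_emb x ^+ n.
Proof. by elim: n => [|n IH]; rewrite ?Psi_emb1 //= Psi_embM IH exprS. Qed.

Lemma Psi_emb_set0 p (x : Psi A p.*2) : (0 < p)%N -> Psi_emb x set0 = 0.
Proof. by move=> p0; apply: const_set0; rewrite doubleK. Qed.

(** [setfun N] is declared as a ring only; this gives the action of k needed for bilinearity and
    signs. *)
Definition setfun_scale c (f : setfun N) : setfun N := fun S => c *: f S.

Lemma setfun_scaleM c f g : setfun_scale c f * g = setfun_scale c (f * g).
Proof.
apply: setfunP => U; rewrite /setfun_scale !setfunM scaler_sumr.
by apply: eq_bigr => S _; rewrite set_mulZl.
Qed.

Lemma Psi_embZ m c (x : Psi A m) : Psi_emb (c *: x) = setfun_scale c (Psi_emb x).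
Proof.
apply: setfunP => S; rewrite /Psi_emb Psi_outZ /setfun_scale /const_setfun.
by case: eqP => [e|_]; rewrite ?transportZ ?scaler0.
Qed.

End PsiEmbedding.

(** All N are required, since an element of A(p) becomes zero in B_N for N < p; the case N = p
    detects it. Every axiom for Psi(A) is thereby reduced to an identity in the rings B_N. *)
Lemma Psi_emb_inj m (x y : Psi A m) :
  (forall N, Psi_emb x = Psi_emb y :> setfun N) -> x = y.
Proof.
move=> h; have [om|em] := boolP (odd m); first by rewrite (Psi_odd x om) (Psi_odd y om).
by rewrite -[x](Psi_outK em) -[y](Psi_outK em); congr Psi_in; apply: const_inj.
Qed.

Lemma Psi_graded_commutative : graded_commutative_algebra (Psi A).
Proof.
split.
- by move=> *; apply: Psi_emb_inj => N; rewrite !(Psi_embM, Psi_embD) mulrDl.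
- by move=> *; apply: Psi_emb_inj => N; rewrite !(Psi_embM, Psi_embD) mulrDr.
- move=> *; apply: Psi_emb_inj => N.
  by rewrite !(Psi_embM, Psi_embZ) setfun_scaleM.
- move=> *; apply: Psi_emb_inj => N.
  by rewrite !(Psi_embM, Psi_embZ) mulrC setfun_scaleM mulrC.
- by move=> *; apply: Psi_emb_inj => N; rewrite !Psi_embM mulrA.
- by move=> *; apply: Psi_emb_inj => N; rewrite Psi_embM Psi_emb1 mul1r.
- by move=> *; apply: Psi_emb_inj => N; rewrite Psi_embM Psi_emb1 mulr1.
- move=> m n l e e' x y; apply: Psi_emb_inj => N; rewrite Psi_embZ !Psi_embM.
  (* The sign can be nontrivial only for odd m, and then [x] is zero. *)
  rewrite -signr_odd oddM; case om: (odd m); last first.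
    by rewrite [LHS]mulrC; apply: setfunP => S; rewrite /setfun_scale expr0 scale1r.
  rewrite (Psi_emb_odd N x om) mul0r mulr0.
  by apply: setfunP => S; rewrite /setfun_scale scaler0.
Qed.

Definition Psi_gamma n p l (e : (n * p.*2)%N = l) (x : Psi A p.*2) : Psi A l :=
  Psi_in (divided n l./2 (Psi_out x)).

Lemma Psi_emb_gamma N n p l (e : (n * p.*2)%N = l) (x : Psi A p.*2) :
  (0 < p)%N -> Psi_emb (Psi_gamma e x) = dpow n (Psi_emb x) :> setfun N.
Proof.
move=> p0; have el : l = (n * p).*2 by rewrite -e doubleMr.
rewrite Psi_emb_in ?const_divided ?doubleK //; first by rewrite el doubleK.
by rewrite el odd_double.
Qed.

Lemma Psi_divided_powers : divided_powers Psi_gamma.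
Proof.
split.
- move=> p e x p0; apply: Psi_emb_inj => N.
  by rewrite Psi_emb_gamma // dpow0 Psi_emb1.
- by move=> p e x p0; apply: Psi_emb_inj => N; rewrite Psi_emb_gamma // dpow1.
- move=> p n m a b l ea eb eab el x p0; apply: Psi_emb_inj => N.
  by rewrite Psi_embM Psi_embMn !Psi_emb_gamma // dpowM // Psi_emb_set0.
- move=> p n l e x y p0; apply: Psi_emb_inj => N.
  rewrite Psi_emb_sum Psi_emb_gamma // Psi_embD dpowD ?Psi_emb_set0 //.
  by apply: eq_bigr => i _; rewrite Psi_embM !Psi_emb_gamma.
- move=> p n [|m] r l e1 e2 e3 x p0 // _; apply: Psi_emb_inj => N.
  have r0 : (0 < r)%N by rewrite -double_gt0 -e1 muln_gt0 double_gt0.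
  by rewrite Psi_embMn !Psi_emb_gamma // dpow_comp // Psi_emb_set0.
- move=> p q r n l e e1 e2 x y q0; apply: Psi_emb_inj => N.
  have r0 : (0 < r)%N by rewrite -double_gt0 -e addn_gt0 !double_gt0 q0 orbT.
  rewrite Psi_embM Psi_emb_pow !Psi_emb_gamma // Psi_embM dpow_mul //.
  exact: Psi_emb_set0.
Qed.

End SetFunctionRing.

(** * The zero algebra and the conclusion *)

Lemma concentrated_Psi (k : comPzRingType) (A : monoid_data k) :
  concentrated_in_even_degrees (Psi A).
Proof. by move=> n on x; apply: Psi_odd. Qed.

(** The left unit law writes every element of A as its product with the unit, which is zero here. *)
Lemma eta_eq0 (k : comPzRingType) (A : monoid_data k) :
  commutative_shuffle_algebra A -> eta A 0%N (1 : k) = 0 ->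
  forall m (x y : Psi A m), x = y.
Proof.
move=> hA eta0.
have A0 l (a : A l) : a = 0.
  have := mu_1l hA (add0n l) erefl 1%g 1 a.
  rewrite scale1r sact1 transport_id => <-.
  rewrite -/(1 : k) eta0 -(scale0r 0) (balZl (gen_balanced A A _)) scale0r.
  by rewrite linear0.
have Psi0 m (x : Psi A m) : x = 0.
  have [om|em] := boolP (odd m); first exact: Psi_odd.
  rewrite -[x](Psi_outK em) -[RHS](Psi_outK em); congr Psi_in.
  by rewrite [LHS]A0 [RHS]A0.
by move=> m x y; rewrite (Psi0 m x) (Psi0 m y).
Qed.

Theorem theorem2p3 (k : comPzRingType) (A : monoid_data k)
    (hA : commutative_shuffle_algebra A)
    (eps : symhom A (unitseq k))
    (heps : is_monoid_hom A (unit_monoid k) eps)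
    (hA0 : bijective (eta A 0%N)) :
  divided_power_algebra (Psi A).
Proof.
(* If the unit of A is zero, then Psi(A) is zero and the zero maps satisfy every axiom; otherwise
   the rings B_N are nonzero. *)
have [/(eta_eq0 hA) triv|/eqP nz] := eqVneq (eta A 0%N (1 : k)) 0.
  split; [by split=> *; apply: triv | exact: concentrated_Psi |].
  by exists (fun _ _ _ _ _ => 0); split=> *; apply: triv.
split; [exact: Psi_graded_commutative nz | exact: concentrated_Psi |].
exists (fun n p l => @Psi_gamma k A hA nz n p l).
exact: Psi_divided_powers.
Qed.
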